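(* Let $L$ be an even positive-definite lattice, $G=L^*/L$, with quadratic form $q$ and symmetric pairing $\langle\cdot,\cdot\rangle$ as below. The following sets are in bijection: (i) the modular invariants for $L$; (ii) the pairs $(J,[\phi])$ with $J\le G$ a subgroup containing no quaternionic elements and $[\phi]\in H^2(J;\mathbb{T})$; (iii) the triples $(D_+,D_-,\sigma)$ where $D_\pm\le G$ are subgroups with $q|_{D_\pm}=1$ and $\sigma:D_+^\perp/D_+\to D_-^\perp/D_-$ is a group isomorphism with $q(\sigma(k))=q(k)$ for all $k\in D_+^\perp$ (where $q$ is regarded as a function on $D_\pm^\perp/D_\pm$); (iv) the subgroups $Z\le G\times G$ with $Z^\perp=Z$ and $q_2|_Z=1$, where $G\times G$ carries the non-degenerate pairing $\langle(g,h),(g',h')\rangle_2=\langle g,g'\rangle\overline{\langle h,h'\rangle}$ and quadratic form $q_2(g,h)=q(g)\overline{q(h)}$, and $\perp$ is taken with respect to $\langle\cdot,\cdot\rangle_2$.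
   Context: An even positive-definite lattice $L$ is a free $\mathbb{Z}$-module of finite rank with positive-definite symmetric bilinear form $u\cdot v$ and $u\cdot u\in2\mathbb{Z}$ for $u\in L$; $L^*=\{v\in\mathbb{R}\otimes L: v\cdot L\subseteq\mathbb{Z}\}$. On $G=L^*/L$ put $q([v])=e^{\pi i v\cdot v}$ and $\langle[u],[v]\rangle=e^{-2\pi i u\cdot v}$ (so $\langle g,h\rangle=q(g)q(h)\overline{q(g+h)}$, a non-degenerate symmetric bicharacter). The modular data for $L$ are the $G\times G$ matrices $S_{g,h}=|G|^{-1/2}\langle g,h\rangle$ and $T_{g,h}=x\,q(g)\delta_{g,h}$ for a fixed nonzero scalar $x$. A modular invariant for $L$ is a matrix $\mathcal{Z}$ indexed by $G$ with nonnegative integer entries, commuting with $S$ and $T$, with $\mathcal{Z}_{0,0}=1$. An element $j\in G$ is quaternionic if the multiplicative order of $\langle j,j\rangle$ equals the order of $j$ in $G$ and this order is even. For a subgroup $D$ of an abelian group with pairing, $D^\perp=\{k:\langle k,d\rangle=1\ \forall d\in D\}$. $H^2(J;\mathbb{T})$ is group cohomology with trivial coefficients. *)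

(* Defs.v *)
From HB Require Import structures.
From mathcomp Require Import all_boot all_order all_algebra all_fingroup.
From mathcomp Require Import reals trigo.
From mathcomp Require Import complex.
Set Implicit Arguments. Unset Strict Implicit. Unset Printing Implicit Defensive.
Import GRing.Theory Num.Theory.
Local Open Scope ring_scope.
Local Open Scope complex_scope.

Definition expi (R : realType) (t : R) : R[i] := cos t +i* sin t.

(* The lattice L = Z^n inside R (x) L = 'rV[R]_n, with bilinear form given by the
   Gram matrix A :  v . w = v A w^T. *)
Definition dotL (R : realType) n (A : 'M[R]_n) (v w : 'rV[R]_n) : R :=
  (v *m A *m w^T) 0 0.
Definition inL (R : realType) n (u : 'rV[R]_n) : Prop :=
  forall i, u 0 i \is a Num.int.
Definition inLdual (R : realType) n (A : 'M[R]_n) (v : 'rV[R]_n) : Prop :=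
  forall u, inL u -> dotL A v u \is a Num.int.

Definition even_pd_lattice (R : realType) n (A : 'M[R]_n) : Prop :=
  [/\ A^T = A,
      (forall u, inL u -> exists k : int, dotL A u u = 2 * k%:~R)
    & (forall v : 'rV[R]_n, v != 0 -> 0 < dotL A v v)].

(* gT (written multiplicatively, as mathcomp groups are) is G = L^*/L via the
   surjective homomorphism pi : L^* -> gT with kernel L; q and the pairing b are
   the functions q([v]) = e^{pi i v.v},  <[u],[v]> = e^{-2 pi i u.v}. *)
Definition discriminant_data (R : realType) n (A : 'M[R]_n) (gT : finGroupType)
    (p : 'rV[R]_n -> gT) (q : gT -> R[i]) (b : gT -> gT -> R[i]) : Prop :=
  [/\ (forall v w, inLdual A v -> inLdual A w -> p (v + w) = (p v * p w)%g),
      (forall g : gT, exists2 v, inLdual A v & p v = g),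
      (forall v, inLdual A v -> (p v = 1%g <-> inL v)),
      (forall v, inLdual A v -> q (p v) = expi (pi * dotL A v v))
    & (forall v w, inLdual A v -> inLdual A w ->
         b (p v) (p w) = expi (- (2 * pi * dotL A v w)))].

Definition Smat (R : realType) (gT : finGroupType) (b : gT -> gT -> R[i])
  (g h : gT) : R[i] := ((Num.sqrt (#|gT|%:R : R))^-1)%:C * b g h.
Definition Tmat (R : realType) (gT : finGroupType) (x : R[i]) (q : gT -> R[i])
  (g h : gT) : R[i] := x * q g * (g == h)%:R.

Definition mx_commute (R : realType) (gT : finGroupType)
    (M N : gT -> gT -> R[i]) : Prop :=
  forall g k : gT, \sum_(h : gT) M g h * N h k = \sum_(h : gT) N g h * M h k.

Definition modular_invariant (R : realType) (gT : finGroupType)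
    (q : gT -> R[i]) (b : gT -> gT -> R[i]) (x : R[i])
    (Z : {ffun gT * gT -> nat}) : Prop :=
  [/\ mx_commute (fun g h => (Z (g, h))%:R) (Smat b),
      mx_commute (fun g h => (Z (g, h))%:R) (Tmat x q)
    & Z (1%g, 1%g) = 1%N].

Definition mult_order (R : realType) (z : R[i]) (k : nat) : Prop :=
  [/\ (0 < k)%N, z ^+ k = 1 & forall m, (0 < m < k)%N -> z ^+ m != 1].

Definition quaternionic (R : realType) (gT : finGroupType)
    (b : gT -> gT -> R[i]) (j : gT) : Prop :=
  mult_order (b j j) #[j]%g /\ ~~ odd #[j]%g.

Definition in_T (R : realType) (z : R[i]) : Prop := `|z| = 1.

Definition cocycle2 (R : realType) (gT : finGroupType) (J : {set gT})
    (phi : gT -> gT -> R[i]) : Prop :=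
  (forall a c, a \in J -> c \in J -> in_T (phi a c)) /\
  (forall a c d, a \in J -> c \in J -> d \in J ->
     phi c d * phi a (c * d)%g = phi (a * c)%g d * phi a c).

Definition cohomologous (R : realType) (gT : finGroupType) (J : {set gT})
    (phi psi : gT -> gT -> R[i]) : Prop :=
  exists f : gT -> R[i], (forall a, a \in J -> in_T (f a)) /\
    (forall a c, a \in J -> c \in J ->
       psi a c = phi a c * (f a * f c / f (a * c)%g)).

Definition perp (R : realType) (gT : finGroupType) (b : gT -> gT -> R[i])
    (D : {set gT}) : {set gT} :=
  [set k | [forall d in D, b k d == 1]].

(* (D+, D-, sigma) data; sigma : D+^perp/D+ -> D-^perp/D- is a group
   isomorphism preserving q (q read on cosets through a representative);
   sigma is normalised to 1 outside D+^perp/D+ so that it is determined by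
   its restriction. *)
Definition triple_ok (R : realType) (gT : finGroupType) (q : gT -> R[i])
    (b : gT -> gT -> R[i]) (Dp Dm : {group gT})
    (sigma : {ffun coset_of Dp -> coset_of Dm}) : Prop :=
  let P := (perp b Dp / Dp)%g in
  let Q := (perp b Dm / Dm)%g in
  [/\ (forall d, d \in Dp -> q d = 1),
      (forall d, d \in Dm -> q d = 1) &
  [/\ {in P &, {morph sigma : c1 c2 / (c1 * c2)%g}},
      {in P &, injective sigma},
      (sigma @: P)%g = Q,
      (forall c, c \notin P -> sigma c = 1%g)
    & (forall c, c \in P -> q (repr (sigma c)) = q (repr c))]].

Definition pair2 (R : realType) (gT : finGroupType) (b : gT -> gT -> R[i])
    (z w : gT * gT) : R[i] := b z.1 w.1 * (b z.2 w.2)^*.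
Definition q2 (R : realType) (gT : finGroupType) (q : gT -> R[i])
    (z : gT * gT) : R[i] := q z.1 * (q z.2)^*.
Definition perp2 (R : realType) (gT : finGroupType) (b : gT -> gT -> R[i])
    (Z : {set gT * gT}) : {set gT * gT} :=
  [set k | [forall z in Z, pair2 b k z == 1]].

Definition ModInv (R : realType) (gT : finGroupType) (q : gT -> R[i])
    (b : gT -> gT -> R[i]) (x : R[i]) :=
  {Z : {ffun gT * gT -> nat} | modular_invariant q b x Z}.

Definition no_quaternionic (R : realType) (gT : finGroupType)
    (b : gT -> gT -> R[i]) (J : {set gT}) : Prop :=
  forall j, j \in J -> ~ quaternionic b j.

Definition Triples (R : realType) (gT : finGroupType) (q : gT -> R[i])
    (b : gT -> gT -> R[i]) :=
  {D : {group gT} * {group gT} &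
     {sigma : {ffun coset_of D.1 -> coset_of D.2} | @triple_ok R gT q b D.1 D.2 sigma}}.

Definition Lagrangians (R : realType) (gT : finGroupType) (q : gT -> R[i])
    (b : gT -> gT -> R[i]) :=
  {Z : {group (gT * gT)} | perp2 b Z = Z /\ (forall z, z \in Z -> q2 q z = 1)}.

(* Main.v *)
(* All four sets are compared with the Lagrangian subgroups W of G x G.

   Commutation with S says that |G| Z(z) is the sum over w of <z,w>_2 Z(w).  At z = 0
   this gives |G| = sum Z, so every entry is 0 or 1, and Z(z) = 1 exactly when z is
   orthogonal to the support of Z; thus Z is the indicator function of a subgroup W
   with W^perp = W, and commutation with T says that q_2 = 1 on W.

   By Goursat's lemma W is the fibre product of D_+^perp and D_-^perp over sigma.

   Put J = {h - g : (g,h) in W} and X(j,k) = <g,k> for (g,g+j) in W.  Then X is a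
   bicharacter of J with X(j,j) = q(j), and W is recovered from (J,X).  Such an X exists
   iff q(j)^ord(j) = 1 on J, i.e. iff J has no quaternionic element, and two of them
   differ by an alternating bicharacter.  Finally phi |-> phi(a,c)/phi(c,a) identifies
   H^2(J;T) with the alternating bicharacters. *)
Require Import Defs.
From HB Require Import structures.
From mathcomp Require Import all_boot all_order all_algebra all_fingroup.
From mathcomp Require Import all_solvable spectral.
From mathcomp Require Import boolp reals trigo.
From mathcomp Require Import complex.
From mathcomp Require Import ring lra zify.
Set Implicit Arguments. Unset Strict Implicit. Unset Printing Implicit Defensive.
Import Order.TTheory GRing.Theory Num.Theory.
Local Open Scope ring_scope.
Local Open Scope complex_scope.

(** This is all that is used of the lattice from here on. Commutativity is a field because G comes
    as a bare [finGroupType]; [qf_inv] is what upgrades polarisation to q(g^n) = q(g)^(n^2). *)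
Record quadratic_form (R : realType) (gT : finGroupType) (q : gT -> R[i])
    (b : gT -> gT -> R[i]) : Prop := QuadraticForm {
  qf_comm : forall g h : gT, (g * h = h * g)%g;
  qf_norm : forall g, `|q g| = 1;
  qf_polar : forall g h, q g * q h = q (g * h)%g * b g h;
  qf_bilin : forall g h k, b (g * h)%g k = b g k * b h k;
  qf_inv : forall g, q g^-1%g = q g;
  qf_nondeg : forall g, (forall h, b g h = 1) -> g = 1%g }.

(** * From the lattice to a non-degenerate quadratic form *)

Section Lattice.
Variable R : realType.

Lemma expiD (s t : R) : expi (s + t) = expi s * expi t.
Proof.
rewrite /expi cosD sinD; apply/eqP; rewrite eq_complex /= eqxx.
by rewrite [in X in _ == X]addrC [sin s * _]mulrC eqxx.
Qed.

Lemma norm_expi (t : R) : `|expi t| = 1.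
Proof. by rewrite /expi normc_def /= cos2Dsin2 sqrtr1. Qed.

Lemma sin_pi_int (k : int) : sin (pi * k%:~R : R) = 0.
Proof.
have sin_nat m : sin (pi * m%:R : R) = 0.
  elim: m => [|m IH]; first by rewrite mulr0 sin0.
  by rewrite -addn1 natrD mulrDr mulr1 sinDpi IH oppr0.
by case: k => m; rewrite ?NegzE ?mulrNz ?mulrN ?sinN -?pmulrn sin_nat ?oppr0.
Qed.

(** The equation cos(2 pi t) = 1 gives sin(pi t) = 0 by the double-angle formula, and the sine has
    no zero strictly between 0 and pi, so the fractional part of t vanishes. *)
Lemma expi_eq1 (t : R) : expi (- (2 * pi * t)) = 1 -> t \is a Num.int.
Proof.
rewrite /expi => -[]; rewrite cosN -mulrA mulr_natl cos_mulr2n => cos2 _.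
have sin_t : sin (pi * t) = 0.
  apply/eqP; rewrite -sqrf_eq0 sin2cos2; apply/eqP; lra.
set k := Num.floor t; have /andP[ge_k lt_k] := floor_itv t.
have : sin (pi * (t - k%:~R)) = 0.
  by rewrite mulrBr sinB sin_t sin_pi_int mul0r mulr0 subr0.
have [tk|tk] := eqVneq t k%:~R; first by rewrite tk intr_int.
have pi_gt0 := pi_gt0 R.
move=> sin0; have /sin_gt0_pi : 0 < pi * (t - k%:~R) < pi.
  apply/andP; split.
    by rewrite mulr_gt0 // subr_gt0 lt_neqAle eq_sym tk.
  by rewrite gtr_pMr //; move: lt_k; rewrite intrD -/k; lra.
by rewrite sin0 ltxx.
Qed.

Variables (n : nat) (A : 'M[R]_n).
Hypothesis latA : even_pd_lattice A.

Lemma dotLDl u v w : dotL A (u + v) w = dotL A u w + dotL A v w.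
Proof. by rewrite /dotL !mulmxDl mxE. Qed.

Lemma dotLC v w : dotL A v w = dotL A w v.
Proof.
have [symA _ _] := latA.
rewrite /dotL -[LHS]/((v *m A *m w^T) 0 0) -[in LHS](trmxK (v *m A *m w^T)) mxE.
by rewrite !trmx_mul trmxK symA mulmxA.
Qed.

Lemma dotLNl v w : dotL A (- v) w = - dotL A v w.
Proof. by rewrite /dotL !mulNmx mxE. Qed.

Lemma gram_unit : A \in unitmx.
Proof.
have [_ _ posA] := latA.
rewrite -row_free_unit -kermx_eq0; apply/eqP/row_matrixP => i.
rewrite row0; apply/eqP/negPn/negP => /posA; rewrite /dotL.
have /eqP-> : row i (kermx A) *m A == 0 by rewrite -sub_kermx row_sub.
by rewrite mul0mx mxE ltxx.
Qed.

Lemma inLdualP v : (forall i, (v *m A) 0 i \is a Num.int) -> inLdual A v.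
Proof.
by move=> vA u uL; rewrite /dotL mxE rpred_sum // => i _; rewrite rpredM // mxE.
Qed.

Lemma inLdualD v w : inLdual A v -> inLdual A w -> inLdual A (v + w).
Proof. by move=> vL wL u uL; rewrite dotLDl rpredD ?vL ?wL. Qed.

Lemma inLdualN v : inLdual A v -> inLdual A (- v).
Proof. by move=> vL u uL; rewrite dotLNl rpredN vL. Qed.

(** Pairing u with the i-th dual basis vector e_i A^-1, an element of L^*, reads off the coordinate
    u_i. This is the source of non-degeneracy. *)
Lemma lattice_double_dual u :
  (forall v, inLdual A v -> dotL A u v \is a Num.int) -> inL u.
Proof.
move=> int_u i; pose v := delta_mx 0 i *m invmx A : 'rV[R]_n.
have /int_u : inLdual A v.
  apply: inLdualP => j; rewrite /v mulmxKV ?gram_unit // mxE.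
  by case: eqP => _; case: eqP => _ /=; rewrite ?rpred0 ?rpred1.
have [symA _ _] := latA.
rewrite /dotL /v trmx_mul trmx_inv symA mulmxA mulmxK ?gram_unit //.
by rewrite trmx_delta -colE mxE.
Qed.

Lemma discriminant_quadratic_form (gT : finGroupType) (p : 'rV[R]_n -> gT) q b :
  discriminant_data A p q b -> quadratic_form q b.
Proof.
move=> [pD p_surj p_ker qE bE].
have p0 : p 0 = 1%g.
  by apply/p_ker => [u uL|i]; rewrite ?mxE ?rpred0 // /dotL !mul0mx mxE rpred0.
split=> [g h|g|g h|g h k|g|g b1].
- have [v vL <-] := p_surj g; have [w wL <-] := p_surj h.
  by rewrite -!pD // addrC.
- by have [v vL <-] := p_surj g; rewrite qE // norm_expi.
- have [v vL <-] := p_surj g; have [w wL <-] := p_surj h.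
  rewrite -pD // !qE ?bE //; last exact: inLdualD.
  rewrite -!expiD; congr expi.
  rewrite dotLDl [dotL A v (v + w)]dotLC [dotL A w (v + w)]dotLC !dotLDl.
  by rewrite [dotL A w v]dotLC !mulrDr mulr2n !mulrDl !mul1r; ring.
- have [v vL <-] := p_surj g; have [w wL <-] := p_surj h.
  have [u uL <-] := p_surj k.
  rewrite -pD // !bE //; last exact: inLdualD.
  by rewrite -expiD -opprD -mulrDr -dotLDl.
- have [v vL <-] := p_surj g; have NvL := inLdualN vL.
  have -> : (p v)^-1%g = p (- v).
    by apply/eqP; rewrite eq_invg_mul -pD // subrr p0.
  by rewrite !qE // dotLNl dotLC dotLNl opprK.
- have [v vL vg] := p_surj g; rewrite -vg; apply/p_ker => //.
  apply: lattice_double_dual => w wL; apply: expi_eq1.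
  by rewrite -bE // vg b1.
Qed.
End Lattice.

(** * Complex numbers of modulus one and character sums *)

Lemma conjc_norm1 (R : rcfType) (z : R[i]) : `|z| = 1 -> (z^*)%R = z^-1.
Proof. by move=> z1; rewrite invC_norm z1 expr1n invr1 mul1r. Qed.

Lemma norm1_neq0 (R : rcfType) (z : R[i]) : `|z| = 1 -> z != 0.
Proof. by move=> z1; rewrite -normr_eq0 z1 oner_eq0. Qed.

Lemma norm1_of_expr (R : rcfType) (z : R[i]) n : (0 < n)%N -> z ^+ n = 1 -> `|z| = 1.
Proof.
move=> n_gt0 zn; apply/eqP; rewrite -(@pexpr_eq1 _ `|z| n) //.
by rewrite -normrX zn normr1.
Qed.

(** Translating the summation index by a multiplies the sum by chi(a), which is not 1. *)
Lemma char_sum0 (F : idomainType) (gT : finGroupType) (J : {group gT})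
    (chi : gT -> F) a :
    {in J &, forall c d, chi (c * d)%g = chi c * chi d} ->
  a \in J -> chi a != 1 -> \sum_(j in J) chi j = 0.
Proof.
move=> chiM aJ chi_a; set S := \sum_(j in J) _.
have : chi a * S = S.
  rewrite mulr_sumr /S [RHS](reindex_inj (mulgI a)) /=.
  apply: eq_big => [j|j jJ]; first by rewrite groupMl.
  by rewrite chiM.
move/eqP; rewrite -[X in _ == X]mul1r -subr_eq0 -mulrBl mulf_eq0 subr_eq0.
by rewrite (negPf chi_a) => /eqP.
Qed.

(** * Duality for finite quadratic forms *)

Section QuadraticForm.
Variables (R : realType) (gT : finGroupType) (q : gT -> R[i]) (b : gT -> gT -> R[i]).
Hypothesis Q : quadratic_form q b.
Local Notation C := R[i].

Lemma q_neq0 g : q g != 0. Proof. exact/norm1_neq0/(qf_norm Q). Qed.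

Lemma b_eq g h : b g h = q g * q h / q (g * h)%g.
Proof. by rewrite (qf_polar Q) mulrC mulKf ?q_neq0. Qed.

Lemma b_sym g h : b g h = b h g.
Proof. by rewrite !b_eq (qf_comm Q h) mulrC [q h * _]mulrC mulrC. Qed.

Lemma norm_b g h : `|b g h| = 1.
Proof. by rewrite b_eq normf_div normrM !(qf_norm Q) mulr1 divr1. Qed.

Lemma b_neq0 g h : b g h != 0. Proof. exact/norm1_neq0/norm_b. Qed.

Lemma bMl g h k : b (g * h)%g k = b g k * b h k. Proof. exact: qf_bilin Q _ _ _. Qed.

Lemma bMr g h k : b k (g * h)%g = b k g * b k h.
Proof. by rewrite !(b_sym k) bMl. Qed.

Lemma b1l h : b 1%g h = 1.
Proof. by apply/(mulfI (b_neq0 1%g h)); rewrite -bMl mulg1 mulr1. Qed.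

Lemma b1r h : b h 1%g = 1. Proof. by rewrite b_sym b1l. Qed.

Lemma bVl g h : b g^-1%g h = (b g h)^-1.
Proof. by apply/(mulfI (b_neq0 g h)); rewrite -bMl mulgV b1l divff ?b_neq0. Qed.

Lemma bVr g h : b h g^-1%g = (b h g)^-1. Proof. by rewrite !(b_sym h) bVl. Qed.

Lemma q1 : q 1%g = 1.
Proof. by apply/(mulfI (q_neq0 1%g)); rewrite (qf_polar Q) b1l mulg1. Qed.

Lemma qM g h : q (g * h)%g = q g * q h / b g h.
Proof. by rewrite (qf_polar Q) mulfK ?b_neq0. Qed.

Lemma abelian_qf (J : {set gT}) : abelian J.
Proof. by apply/centsP => g _ h _; exact: (qf_comm Q). Qed.

Lemma perpP (D : {set gT}) k :
  reflect (forall d, d \in D -> b k d = 1) (k \in perp b D).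
Proof.
rewrite inE; apply: (iffP forall_inP) => kD d /kD; first by move/eqP.
by move=> ->.
Qed.

Lemma group_set_perp (D : {set gT}) : group_set (perp b D).
Proof.
apply/group_setP; split=> [|g h /perpP gD /perpP hD]; apply/perpP => d dD.
  by rewrite b1l.
by rewrite bMl gD ?hD ?mulr1.
Qed.
Definition perp_group (D : {set gT}) := Group (group_set_perp D).

Lemma char_sum_b (h : gT) : \sum_g b g h = (#|gT| * (h == 1%g))%:R.
Proof.
have [->|h1] := eqVneq h 1%g.
  by under eq_bigr do rewrite b1r; rewrite sumr_const muln1.
rewrite muln0; have [g gh] : exists g, b g h != 1.
  apply/existsP; apply: contraR h1 => /existsPn bh1.
  by apply/eqP/(qf_nondeg Q) => g; rewrite b_sym; apply/eqP/negPn/bh1.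
transitivity (\sum_(k in [set: gT]) b k h).
  by apply: eq_bigl => k; rewrite inE.
by apply: (@char_sum0 _ _ _ (b^~ h) g); rewrite ?inE // => c d _ _; exact: bMl.
Qed.

(** Double counting of the sum of b(g,j) over G x J: summing over j first leaves |J| for each g in
    the orthogonal of J, summing over g first leaves |G| from j = 1 alone. *)
Lemma perp_card (J : {group gT}) : (#|J| * #|perp b J| = #|gT|)%N.
Proof.
apply/eqP; rewrite -(eqr_nat C); apply/eqP.
transitivity (\sum_(g : gT) \sum_(j in J) b g j).
  rewrite (bigID [in perp b J]) /= [X in _ + X]big1 => [|g gJ].
    under eq_bigr => g /perpP gJ do rewrite (eq_bigr (fun=> 1)) // sumr_const.
    by rewrite sumr_const addr0 -mulrnA mulnC.
  have [j jJ gj] : exists2 j, j \in J & b g j != 1.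
    by move: gJ; rewrite inE negb_forall_in => /exists_inP.
  by apply: (@char_sum0 _ _ _ (b g) j) => // c d _ _; exact: bMr.
rewrite exchange_big /=.
under eq_bigr do rewrite char_sum_b.
rewrite (bigD1 1%g) //= eqxx muln1 big1 ?addr0 // => j /andP[_ /negPf->].
by rewrite muln0.
Qed.

(** The sum of b(g,j) chi(j) over G x J is |G|, so for some g the inner sum over J is nonzero; then
    b(g,-) chi is trivial on J and g^-1 represents chi. *)
Lemma char_ext (J : {group gT}) (chi : gT -> C) :
    {in J &, forall c d, chi (c * d)%g = chi c * chi d} ->
    {in J, forall c, `|chi c| = 1} ->
  exists g, forall j, j \in J -> b g j = chi j.
Proof.
move=> chiM chi_norm.
have chi_neq0 c : c \in J -> chi c != 0 by move/chi_norm/norm1_neq0.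
have chi1 : chi 1%g = 1.
  by apply/(mulfI (chi_neq0 _ (group1 J))); rewrite -chiM ?mulg1 ?mulr1.
have : \sum_(g : gT) \sum_(j in J) b g j * chi j != 0.
  rewrite exchange_big /=.
  under eq_bigr do rewrite -mulr_suml char_sum_b.
  rewrite (bigD1 1%g) //= eqxx chi1 mulr1 big1 ?addr0 => [|j /andP[_ /negPf->]].
    by rewrite pnatr_eq0 muln1 -lt0n; apply/card_gt0P; exists 1%g.
  by rewrite muln0 mul0r.
move=> S_neq0; have [g Sg] : exists g, \sum_(j in J) b g j * chi j != 0.
  apply/existsP; apply: contraR S_neq0 => /existsPn S0; apply/eqP/big1 => g _.
  exact/eqP/negPn/S0.
exists g^-1%g => j jJ; apply/eqP/negPn/negP => bj; case/negP: Sg; apply/eqP.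
apply: (@char_sum0 _ _ _ (fun j => b g j * chi j) j) => //= [c d cJ dJ|].
  by rewrite bMr chiM // mulrACA.
apply: contraNneq bj => bchi; rewrite bVl; apply/eqP/(mulfI (b_neq0 g j)).
by rewrite divff ?b_neq0 // bchi.
Qed.

Lemma perpK (J : {group gT}) : perp b (perp b J) = J.
Proof.
apply/esym/eqP; rewrite eqEcard; apply/andP; split.
  by apply/subsetP => j jJ; apply/perpP => k /perpP kJ; rewrite b_sym kJ.
have := perp_card (perp_group J); rewrite -(perp_card J) /= mulnC => /eqP.
rewrite eqn_pmul2r ?(cardG_gt0 (perp_group J)) // => /eqP->.
exact: leqnn.
Qed.

End QuadraticForm.

(** * Modular invariants and Lagrangian subgroups *)

Section Lagrangian.
Variables (R : realType) (gT : finGroupType) (q : gT -> R[i]) (b : gT -> gT -> R[i]).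
Hypothesis Q : quadratic_form q b.
Local Notation C := R[i].
Implicit Types (z w : gT * gT) (W : {group gT * gT}).

Lemma pair2E z w : pair2 b z w = b z.1 w.1 / b z.2 w.2.
Proof. by rewrite /pair2 conjc_norm1 // (norm_b Q). Qed.

Lemma q2E z : q2 q z = q z.1 / q z.2.
Proof. by rewrite /q2 conjc_norm1 // (qf_norm Q). Qed.

Lemma q2_eq1 z : q2 q z = 1 <-> q z.1 = q z.2.
Proof.
rewrite q2E; split=> [/divr1_eq //|->]; by rewrite divff ?(q_neq0 Q).
Qed.

Lemma pair2_eq1 z w : pair2 b z w = 1 <-> b z.1 w.1 = b z.2 w.2.
Proof.
rewrite pair2E; split=> [/divr1_eq //|->]; by rewrite divff ?(b_neq0 Q).
Qed.

(** Since G x G satisfies the same axioms, the duality results above apply to its subgroups and to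
    [perp2]. *)
Lemma quadratic_form2 : quadratic_form (q2 q) (pair2 b).
Proof.
split=> [[g h] [g' h']|z|z w|z w y|z|z zw1].
- by congr pair; exact: qf_comm Q _ _.
- by rewrite q2E normf_div !(qf_norm Q) divr1.
- by rewrite !q2E pair2E mulf_div !(qf_polar Q) -mulf_div.
- by rewrite !pair2E !(bMl Q) mulf_div.
- by rewrite !q2E !(qf_inv Q).
case: z zw1 => g h gh1; congr pair; apply/(qf_nondeg Q) => k.
  by have := gh1 (k, 1%g); rewrite pair2E /= (b1r Q) divr1.
by have := gh1 (1%g, k) => /pair2_eq1 /=; rewrite (b1r Q).
Qed.
Let Q2 := quadratic_form2.

Definition lagrangian W := perp2 b W = W /\ (forall z, z \in W -> q2 q z = 1).

Lemma isotropic_perp2 W z w :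
    (forall z, z \in W -> q2 q z = 1) -> z \in W -> w \in W -> pair2 b z w = 1.
Proof.
move=> qW zW wW; have := qf_polar Q2 z w.
by rewrite !qW ?groupM // !mul1r => ->.
Qed.

Lemma lagrangianP W : (forall z, z \in W -> q2 q z = 1) ->
  (forall z, (forall w, w \in W -> pair2 b z w = 1) -> z \in W) -> lagrangian W.
Proof.
move=> qW max_W; split=> //; apply/setP => z.
apply/(perpP (pair2 b))/idP => [/max_W //|zW w wW].
exact: isotropic_perp2 qW zW wW.
Qed.

Lemma lagrangian_card W : lagrangian W -> #|W| = #|gT|.
Proof.
move=> [perpW _]; have := perp_card Q2 W.
rewrite -[perp _ _]/(perp2 b W) perpW card_prod => /eqP.
by rewrite !mulnn eqn_sqr => /eqP.
Qed.


Variables (x : C) (x_neq0 : x != 0).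

Lemma commute_Tmat (Z : {ffun gT * gT -> nat}) :
  mx_commute (fun g h => (Z (g, h))%:R) (Tmat x q) <->
  (forall z, Z z != 0%N -> q2 q z = 1).
Proof.
have E g k : (\sum_h (Z (g, h))%:R * Tmat x q h k
      == \sum_h Tmat x q g h * (Z (h, k))%:R)
    = (Z (g, k) == 0%N) || (q g == q k).
  rewrite (bigD1 k) //= [X in _ + X]big1 => [|h /negPf hk]; last first.
    by rewrite /Tmat hk !mulr0.
  rewrite [X in _ == X](bigD1 g) //=.
  rewrite [X in _ == _ + X]big1 => [|h /negPf hg]; last first.
    by rewrite /Tmat eq_sym hg mulr0 mul0r.
  rewrite /Tmat !eqxx !mulr1 !addr0 mulrC -subr_eq0 -mulrBl -mulrBr !mulf_eq0.
  by rewrite (negPf x_neq0) pnatr_eq0 subr_eq0 orbC [q k == _]eq_sym.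
split=> [cZ [g k] Zgk|qZ g k]; last first.
  apply/eqP; rewrite E; have [//|/qZ/q2_eq1 /= ->] := eqVneq (Z (g, k)) 0%N.
  exact: eqxx.
by apply/q2_eq1; have /eqP := cZ g k; rewrite E (negPf Zgk) => /eqP.
Qed.

(** S is a Fourier matrix: up to a scalar, its inverse has entries b(g,h)^-1. Moving S across ZS =
    SZ writes Z, up to the factor |G|, as its own two-variable Fourier transform with kernel
    [pair2]. *)
Lemma commute_Smat (Z : {ffun gT * gT -> nat}) :
  mx_commute (fun g h => (Z (g, h))%:R) (Smat b) <->
  (forall z, #|gT|%:R * (Z z)%:R = \sum_w pair2 b z w * (Z w)%:R :> C).
Proof.
have cG_neq0 : #|gT|%:R != 0 :> C.
  by rewrite pnatr_eq0 -lt0n; apply/card_gt0P; exists 1%g.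
have s_neq0 : ((Num.sqrt (#|gT|%:R : R))^-1)%:C != 0.
  by rewrite fmorph_eq0 invr_eq0 sqrtr_eq0 -ltNge ltr0n; apply/card_gt0P; exists 1%g.
set s := _%:C in s_neq0.
have SE g k : (\sum_h (Z (g, h))%:R * Smat b h k = \sum_h Smat b g h * (Z (h, k))%:R)
    <-> (\sum_h (Z (g, h))%:R * b h k = \sum_h b g h * (Z (h, k))%:R).
  transitivity (s * (\sum_h (Z (g, h))%:R * b h k)
      = s * \sum_h b g h * (Z (h, k))%:R).
    rewrite !mulr_sumr; under eq_bigr do rewrite mulrCA.
    by under [in X in _ = X <-> _]eq_bigr do rewrite -mulrA.
  by split=> [/(mulfI s_neq0)|->].
have delta (l h : gT) (c : C) :
    c * \sum_k b h k / b l k = (if h == l then c * #|gT|%:R else 0).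
  under eq_bigr => k do rewrite -(bVl Q) -(bMl Q) (b_sym Q).
  rewrite (char_sum_b Q) -eq_mulgV1; case: eqP; by rewrite ?muln1 ?muln0 ?mulr0.
(* Forward, the k-th equation in row g is weighted by b(l,k)^-1 and summed over k; backward, summing
   over h singles out the terms with second coordinate k. *)
split=> [cZ [g l]|FZ g k].
  transitivity (\sum_k (b l k)^-1 * \sum_h b g h * (Z (h, k))%:R); last first.
    under eq_bigr do rewrite mulr_sumr.
    rewrite exchange_big pair_bigA /=; apply: eq_bigr => -[h k] _ /=.
    by rewrite pair2E /= mulrA [_^-1 * _]mulrC.
  under eq_bigr => k _ do rewrite -(proj1 (SE g k) (cZ g k)) mulr_sumr.
  rewrite exchange_big /=.
  under eq_bigr => h _.
    under eq_bigr do rewrite mulrCA [_^-1 * _]mulrC.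
    rewrite -mulr_sumr delta; over.
  by rewrite -big_mkcond big_pred1_eq mulrC.
apply/SE/(mulfI cG_neq0); rewrite [LHS]mulr_sumr.
under eq_bigr => h _ do rewrite mulrA FZ mulr_suml.
rewrite exchange_big /=.
pose F g' h' := if k == h' then b g g' * (Z (g', h'))%:R * #|gT|%:R else 0.
transitivity (\sum_(w : gT * gT) F w.1 w.2).
  apply: eq_bigr => -[g' h'] _ /=; rewrite /F -delta mulr_sumr.
  apply: eq_bigr => h _; rewrite pair2E /= ![b _ h](b_sym Q) -!mulrA.
  by congr (_ * _); rewrite mulrCA [_^-1 * _]mulrC.
rewrite -(pair_bigA _ F) /= /F.
rewrite mulr_sumr; apply: eq_bigr => h _.
rewrite -big_mkcond (big_pred1 k) => [|j]; first by rewrite mulrC.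
by rewrite /= eq_sym.
Qed.

(** The Fourier sum of the indicator of W is the sum of the character [pair2 b z] over W: it is |W|
    = |G| when z lies in W, and 0 otherwise. *)
Lemma lagrangian_modular_invariant W : lagrangian W ->
  modular_invariant q b x [ffun z => nat_of_bool (z \in W)].
Proof.
move=> lagW; have [perpW qW] := lagW; split; last by rewrite ffunE group1.
  apply/commute_Smat => z; under eq_bigr do rewrite ffunE mulr_natr mulrb.
  rewrite -big_mkcond /= ffunE; have [zW|zW] := boolP (z \in W).
    under eq_bigr => w wW do rewrite (isotropic_perp2 qW zW wW).
    by rewrite mulr1 sumr_const lagrangian_card.
  rewrite mulr0; move: zW; rewrite -perpW inE negb_forall_in.
  move=> /exists_inP[w wW zw]; apply/esym.
  rewrite perpW; apply: (@char_sum0 _ _ _ (pair2 b z) w) => // c d _ _.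
  exact: bMr Q2 _ _ _.
by apply/commute_Tmat => z; rewrite ffunE eqb0 negbK => /qW.
Qed.

Lemma modular_invariant_lagrangian Z : modular_invariant q b x Z ->
  exists2 W, lagrangian W & Z = [ffun z => nat_of_bool (z \in W)].
Proof.
move=> [/commute_Smat ZS /commute_Tmat Zq Z1].
have cG_gt0 : 0 < #|gT|%:R :> C by rewrite ltr0n; apply/card_gt0P; exists 1%g.
have sumZ : #|gT|%:R = \sum_w (Z w)%:R :> C.
  have := ZS (1%g, 1%g); rewrite Z1 mulr1 => ->; apply: eq_bigr => w _.
  by rewrite (b1l Q2) mul1r.
have normZ z w : `|pair2 b z w * (Z w)%:R| <= (Z w)%:R.
  by rewrite normrM (norm_b Q2) mul1r normr_nat.
(* Triangle inequality in the Fourier identity: |G| Z(z) is at most the sum of all entries, which is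
   |G|. *)
have Z_le1 z : (Z z <= 1)%N.
  rewrite -(ler_nat C) -(ler_pM2l cG_gt0) mulr1 [leRHS]sumZ.
  have -> : #|gT|%:R * (Z z)%:R = `|#|gT|%:R * (Z z)%:R| :> C.
    by rewrite normrM !normr_nat.
  by rewrite ZS; apply: le_trans (ler_norm_sum _ _ _) (ler_sum _ _) => w _.
pose D := [set z | Z z != 0%N].
have perpD z : (z \in perp (pair2 b) D) = (Z z != 0%N).
  apply/perpP/idP => [zD|Zz w].
    suff : #|gT|%:R * (Z z)%:R != 0 :> C.
      by rewrite mulf_eq0 => /norP[_]; rewrite pnatr_eq0.
    rewrite ZS (_ : \sum_w _ = #|gT|%:R) ?gt_eqF // sumZ; apply: eq_bigr => w _.
    have [->|Zw] := eqVneq (Z w) 0%N; first by rewrite mulr0.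
    by rewrite zD ?mul1r // inE.
  rewrite inE => Zw; have Zz1 : Z z = 1%N.
    by apply/eqP; rewrite eqn_leq Z_le1 lt0n.
  (* Equality case of the triangle inequality: each summand has modulus at most Z(w) and the total
     attains the sum of the Z(w), so every summand equals Z(w). *)
  have := ZS z; rewrite Zz1 mulr1 sumZ => /esym sum_eq.
  have Zw_neq0 : (Z w)%:R != 0 :> C by rewrite pnatr_eq0.
  apply: (mulIf Zw_neq0); rewrite mul1r.
  exact: (normC_sum_upper (fun w _ => normZ z w) sum_eq).
exists (perp_group Q2 D); last first.
  apply/ffunP => z; rewrite ffunE perpD.
  by case: (Z z) (Z_le1 z) => [|[]].
have WE : perp_group Q2 D = D :> {set _} by apply/setP => z; rewrite perpD inE.
split; first by rewrite WE.
by move=> z; rewrite perpD => /Zq.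
Qed.

End Lagrangian.

(** * Lagrangian subgroups and bicharacters *)

Section Bicharacter.
Variables (R : realType) (gT : finGroupType) (J : {group gT}).
Implicit Type X : gT -> gT -> R[i].

Definition bichar X : Prop :=
  [/\ {in J & &, forall a c d, X (a * c)%g d = X a d * X c d},
      {in J & &, forall a c d, X a (c * d)%g = X a c * X a d}
    & {in J &, forall a c, `|X a c| = 1}].

Lemma bichar_neq0 X a c : bichar X -> a \in J -> c \in J -> X a c != 0.
Proof. by case=> _ _ normX aJ cJ; exact/norm1_neq0/normX. Qed.

Lemma bichar1l X c : bichar X -> c \in J -> X 1%g c = 1.
Proof.
move=> bX cJ; have [Xl _ _] := bX; have J1 := group1 J.
by apply/(mulfI (bichar_neq0 bX J1 cJ)); rewrite -Xl ?mulg1 ?mulr1.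
Qed.

Lemma bicharXl X a c n : bichar X -> a \in J -> c \in J ->
  X (a ^+ n)%g c = X a c ^+ n.
Proof.
move=> bX aJ cJ; have [Xl _ _] := bX.
by elim: n => [|n IH]; rewrite ?bichar1l // expgS Xl ?groupX // IH exprS.
Qed.

Lemma bicharM X Y : bichar X -> bichar Y -> bichar (fun a c => X a c * Y a c).
Proof.
move=> [Xl Xr Xn] [Yl Yr Yn]; split=> [a c d aJ cJ dJ|a c d aJ cJ dJ|a c aJ cJ].
- by rewrite Xl ?Yl // mulrACA.
- by rewrite Xr ?Yr // mulrACA.
- by rewrite normrM Xn ?Yn ?mulr1.
Qed.

Lemma bicharV X : bichar X -> bichar (fun a c => (X a c)^-1).
Proof.
move=> [Xl Xr Xn]; split=> [a c d aJ cJ dJ|a c d aJ cJ dJ|a c aJ cJ].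
- by rewrite Xl ?invfM.
- by rewrite Xr ?invfM.
- by rewrite normfV Xn ?invr1.
Qed.
End Bicharacter.

Lemma bicharS (R : realType) (gT : finGroupType) (J K : {group gT})
    (X : gT -> gT -> R[i]) : {subset K <= J} -> bichar J X -> bichar K X.
Proof.
move=> sKJ [Xl Xr Xn].
split.
- by move=> a c d /sKJ aJ /sKJ cJ /sKJ dJ; exact: Xl.
- by move=> a c d /sKJ aJ /sKJ cJ /sKJ dJ; exact: Xr.
- by move=> a c /sKJ aJ /sKJ cJ; exact: Xn.
Qed.

(** * Gluing a bicharacter into a Lagrangian subgroup *)

Section Glue.
Variables (R : realType) (gT : finGroupType) (q : gT -> R[i]) (b : gT -> gT -> R[i]).
Hypothesis Q : quadratic_form q b.
Local Notation C := R[i].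
Implicit Types (W : {group gT * gT}) (J : {group gT}) (X : gT -> gT -> C).

Definition quad_bichar J X := bichar J X /\ {in J, forall j, X j j = q j}.

(* W = {(g, gj) : j in J, b g = X j on J}; every W^perp = W with q2 = 1 on W is of
   this form, and then q(gj) = q(g) forces X j j = q j. *)
Definition glue J X W := forall g h, (g, h) \in W <->
  (g^-1 * h)%g \in J /\ {in J, forall k, b g k = X (g^-1 * h)%g k}.

(** Bilinear expansion of X(jk,jk) = q(jk), compared with the polarisation of q. The symmetrisation
    of X is forced to be b^-1, which is what makes the glued subgroup maximal. *)
Lemma quad_bichar_polar J X j k : quad_bichar J X -> j \in J -> k \in J ->
  X j k * X k j * b j k = 1.
Proof.
move=> [[Xl Xr Xn] Xq] jJ kJ; have := qf_polar Q j k.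
have XjkN : X j j * X k k != 0 by rewrite mulf_neq0 // norm1_neq0 ?Xn.
rewrite -!Xq ?groupM // Xl ?groupM // !Xr // => E; apply: (mulfI XjkN).
by rewrite mulr1 [RHS]E; ring.
Qed.

Lemma glue_char_ext J X j : bichar J X -> j \in J ->
  exists g, {in J, forall k, b g k = X j k}.
Proof.
move=> [Xl Xr Xn] jJ.
by apply: (char_ext Q) => [c d cJ dJ|c cJ]; [exact: Xr | exact: Xn].
Qed.

(** Isotropy: q(gj) = q(g) q(j) / b(g,j), and b(g,j) = X(j,j) = q(j). Maximality is tested on two
    families in W. *)
Lemma glue_lagrangian J X W : quad_bichar J X -> glue J X W -> lagrangian q b W.
Proof.
move=> qX gW; have [bX Xq] := qX; apply: (lagrangianP Q) => -[g h].
  move=> /gW[jJ bgX]; apply/(q2_eq1 Q) => /=.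
  have -> : h = (g * (g^-1 * h))%g by rewrite mulKVg.
  by rewrite (qM Q) bgX // Xq // mulfK ?(q_neq0 Q).
move=> perp_gh; set j := (g^-1 * h)%g.
have bg t u : (t, u) \in W -> b g t = b h u.
  by move/perp_gh/(pair2_eq1 Q).
(* The diagonal elements (t,t) with t orthogonal to J force j into the double orthogonal of J. *)
have jJ : j \in J.
  rewrite -(perpK Q J); apply/perpP => t /perpP tJ.
  have /bg E : (t, t) \in W.
    by apply/gW; rewrite mulVg group1; split=> // k kJ; rewrite tJ // (bichar1l bX).
  by rewrite (bMl Q) (bVl Q) E mulVf ?(b_neq0 Q).
(* For k in J, pairing with (t,tk), where b(t,-) = X(k,-) on J, gives b(g,k) X(k,j) b(j,k) = 1, and
   [quad_bichar_polar] turns this into b(g,k) = X(j,k). *)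
apply/gW; rewrite -/j; split=> // k kJ; have [t tX] := glue_char_ext bX kJ.
have /bg : (t, t * k)%g \in W by apply/gW; rewrite mulKg.
have -> : h = (g * j)%g by rewrite mulKVg.
rewrite (bMl Q) !(bMr Q) [b j t](b_sym Q) tX // => E.
have kN : X k j * b j k != 0 by rewrite mulf_neq0 ?(b_neq0 Q) ?(bichar_neq0 bX).
apply: (mulIf kN); rewrite !mulrA (quad_bichar_polar qX jJ kJ).
by apply: (mulfI (b_neq0 Q g t)); rewrite mulr1 [RHS]E !mulrA.
Qed.

Lemma glue_exists J X : quad_bichar J X -> exists W, glue J X W.
Proof.
move=> [bX Xq]; have [Xl Xr Xn] := bX.
pose D := [set z | (z.1^-1 * z.2)%g \in J &
  [forall k in J, b z.1 k == X (z.1^-1 * z.2)%g k]].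
have inD g h : reflect ((g^-1 * h)%g \in J /\
    {in J, forall k, b g k = X (g^-1 * h)%g k}) ((g, h) \in D).
  rewrite inE /=; apply: (iffP andP) => -[jJ gX]; split=> //.
    by move=> k kJ; apply/eqP/(forall_inP gX).
  by apply/forall_inP => k kJ; rewrite gX.
have gD : group_set D.
  apply/group_setP; split.
    apply/inD; rewrite invg1 mulg1; split=> // k kJ.
    by rewrite (b1l Q) (bichar1l bX).
  move=> [g h] [g' h'] /inD[jJ gX] /inD[jJ' gX'].
  have E : ((g * g')^-1 * (h * h') = g^-1 * h * (g'^-1 * h'))%g.
    rewrite invMg -!mulgA (qf_comm Q g'^-1%g) -!mulgA.
    by rewrite (qf_comm Q h').
  apply/inD; rewrite E; split=> [|k kJ]; first exact: groupM.
  by rewrite (bMl Q) gX ?gX' // [RHS]Xl.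
exists (Group gD) => g h; split=> [/inD|ghX]; [by []|exact/inD].
Qed.

(** Every j in J occurs as g^-1 h for some (g,h) in W, because X(j,-) extends to some b(g,-); then
    X(j,-) is the restriction of b(g,-). So W determines both J and X. *)
Lemma glue_inj J J' X X' W : bichar J X -> bichar J' X' ->
  glue J X W -> glue J' X' W -> J = J' /\ {in J &, X =2 X'}.
Proof.
move=> bX bX' gW gW'.
have key j : j \in J -> j \in J' /\ {in J & J', forall k k', k = k' -> X j k = X' j k}.
  move=> jJ; have [g gX] := glue_char_ext bX jJ.
  have : (g, g * j)%g \in W by apply/gW; rewrite mulKg.
  move=> /gW'[]; rewrite mulKg => jJ' gX'; split=> // k k' kJ kJ' kk'.
  by rewrite -gX // gX' // kk'.
have sJ' j : j \in J' -> j \in J.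
  move=> jJ; have [g gX] := glue_char_ext bX' jJ.
  have : (g, g * j)%g \in W by apply/gW'; rewrite mulKg.
  by move=> /gW[]; rewrite mulKg.
split; first by apply/group_inj/setP => j; apply/idP/idP => [/key[]|/sJ'].
move=> j k jJ kJ; have [_ /(_ k k kJ)] := key j jJ.
by apply=> //; have [] := key k kJ.
Qed.

Lemma eq_glue J X X' W : {in J &, X =2 X'} -> glue J X W -> glue J X' W.
Proof.
move=> eqX gW g h; split=> [/gW[jJ gX]|[jJ gX]].
  by split=> // k kJ; rewrite -eqX ?gX.
by apply/gW; split=> // k kJ; rewrite eqX ?gX.
Qed.

Lemma glue_fun J X W W' : glue J X W -> glue J X W' -> W = W'.
Proof.
move=> gW gW'; apply/group_inj/setP => -[g h].
by apply/idP/idP => [/gW/gW'|/gW'/gW].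
Qed.

Lemma lagrangian_glue W : lagrangian q b W ->
  exists J X, quad_bichar J X /\ glue J X W.
Proof.
move=> [perpW qW].
have bW g h g' h' : (g, h) \in W -> (g', h') \in W -> b g g' = b h h'.
  move=> ghW ghW'.
  exact/(pair2_eq1 Q (g, h) (g', h'))/(isotropic_perp2 Q qW ghW ghW').
pose D := [set (z.1^-1 * z.2)%g | z in W].
have inD j : reflect (exists g, (g, g * j)%g \in W) (j \in D).
  apply: (iffP imsetP) => [[[g h] ghW ->]|[g gW]]; first by exists g; rewrite mulKVg.
  by exists (g, g * j)%g; rewrite //= mulKg.
have gD : group_set D.
  apply/group_setP; split; first by apply/inD; exists 1%g; rewrite mulg1 group1.
  move=> j k /inD[g gW] /inD[h hW]; apply/inD; exists (g * h)%g.
  have := groupM gW hW; congr (_ \in W); congr pair => /=.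
  by rewrite -!mulgA; congr (_ * _)%g; rewrite !mulgA (qf_comm Q j).
(* Here g is any base point with (g,gj) in W; the default 1 occurs only for j outside D. *)
pose X j k := if [pick g | (g, g * j)%g \in W] is Some g then b g k else 1.
have XE g j k : (g, g * j)%g \in W -> k \in D -> X j k = b g k.
  rewrite /X => gW /inD[t tW]; case: pickP => [h hW|/(_ g)]; last by rewrite gW.
  (* Two base points g and h for j differ by a diagonal element of W, which is orthogonal to (t,tk),
     so b(hg^-1,k) = 1 and X(j,k) does not depend on the choice. *)
  have /bW/(_ tW) : (h * g^-1, h * g^-1)%g \in W.
    have := groupM hW (groupVr gW); congr (_ \in W); congr pair => /=.
    rewrite invMg (qf_comm Q h) !mulgA; congr (_ * _)%g.
    by rewrite -!mulgA [(h * _)%g](qf_comm Q) mulKVg.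
  rewrite (bMr Q) -[LHS]mulr1 => /(mulfI (b_neq0 Q _ _))/esym.
  by rewrite (bMl Q) (bVl Q) => /divr1_eq.
exists (Group gD), X; split.
  split; first split=> /=.
  - move=> j k l /inD[g gW] /inD[h hW] lD; rewrite (XE g j) // (XE h k) // -(bMl Q).
    apply: XE => //; have := groupM gW hW; congr (_ \in W); congr pair => /=.
    by rewrite -!mulgA; congr (_ * _)%g; rewrite !mulgA (qf_comm Q j).
  - move=> j k l /inD[g gW] kD lD; rewrite !(XE g j) ?(bMr Q) //.
    exact: (groupM (G := Group gD)).
  - by move=> j k /inD[g gW] kD; rewrite (XE g) ?(norm_b Q).
  - move=> j jD; have /inD[g gW] := jD; rewrite (XE g) //.
    have /(q2_eq1 Q)/= := qW _ gW; rewrite (qM Q) => E.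
    by apply: (mulfI (q_neq0 Q g)); rewrite [in LHS]E mulfVK ?(b_neq0 Q).
  move=> g h; split=> [ghW|[/inD[t tW] gX]].
    have jD : (g^-1 * h)%g \in D by apply/inD; exists g; rewrite mulKVg.
    by split=> // k kD; rewrite (XE g) // mulKVg.
  (* Conversely, b(g,-) and b(t,-) agree on D while (t,tj) is in W, so (g,gj) is orthogonal to W as
     well. *)
  rewrite -perpW; apply/(perpP (pair2 b)) => -[g' h'] ghW'.
  set j := (g^-1 * h)%g in tW gX *.
  have kD : (g'^-1 * h')%g \in D by apply/inD; exists g'; rewrite mulKVg.
  have := bW _ _ _ _ tW ghW'.
  rewrite (bMl Q) => E2; have := gX _ kD; rewrite (XE t) // !(bMr Q) !(bVr Q).
  rewrite ![(b _ g')^-1 * _]mulrC => /eqP.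
  rewrite eqr_div ?(b_neq0 Q) // E2 => /eqP E1; apply/(pair2_eq1 Q) => /=.
  have -> : h = (g * j)%g by rewrite mulKVg.
  by apply: (mulfI (b_neq0 Q t h')); rewrite (bMl Q) -E1; ring.
Qed.
End Glue.

(** * Existence of bicharacters *)

Section CyclicDecomposition.
Variables (R : realType) (gT : finGroupType).
Local Notation C := R[i].
Implicit Types (J K : {group gT}) (X : gT -> gT -> C).

Lemma expr_eq_mod (z : C) N n m : z ^+ N = 1 -> n = m %[mod N] -> z ^+ n = z ^+ m.
Proof. by move=> zN nm; rewrite -(expr_mod n zN) nm expr_mod. Qed.

(** The extension step behind both constructions below: Y(x,x) = z, Y(x,l) = chi(l), Y(k,x) = 1 and
    Y = X on K. The root-of-unity conditions make exponents of x matter only modulo its order.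
    Putting the whole cross term on one side avoids any division by 2. *)
Lemma bichar_dprod_cycle J K (x : gT) X (z : C) (chi : gT -> C) :
    (<[x]> \x K)%g = J -> bichar K X -> z ^+ #[x]%g = 1 ->
    {in K &, forall c d, chi (c * d)%g = chi c * chi d} ->
    {in K, forall c, chi c ^+ #[x]%g = 1} ->
  exists2 Y, bichar J Y & forall n m, {in K &, forall k l,
    Y (x ^+ n * k)%g (x ^+ m * l)%g = z ^+ (n * m) * chi l ^+ n * X k l}.
Proof.
move=> defJ [Xl Xr Xn] zx chiM chix.
have [_ defJ' cxK tixK] := dprodP defJ.
(* The exponent of the <x>-component of j; on J the default 0 is never reached. *)
pose e j := if [pick i : 'I_#[x]%g | x ^+ i == divgr <[x]> K j]%g is Some i
  then nat_of_ord i else 0%N.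
pose r j := remgr <[x]> K j.
have rE n k : k \in K -> r (x ^+ n * k)%g = k.
  by move=> kK; rewrite /r remgrMid ?mem_cycle.
have eE n k : k \in K -> e (x ^+ n * k)%g = n %[mod #[x]%g].
  move=> kK; rewrite /e divgrMid ?mem_cycle //.
  case: pickP => [i /eqP/eqP|]; first by rewrite eq_expg_mod_order => /eqP.
  have lt_n : (n %% #[x]%g < #[x]%g)%N by rewrite ltn_mod order_gt0.
  by move/(_ (Ordinal lt_n)); rewrite /= expg_mod_order eqxx.
pose Y j l := z ^+ (e j * e l) * chi (r l) ^+ e j * X (r j) (r l).
have YE n m : {in K &, forall k l,
    Y (x ^+ n * k)%g (x ^+ m * l)%g = z ^+ (n * m) * chi l ^+ n * X k l}.
  move=> k l kK lK; rewrite /Y !rE //; congr (_ * _ * _).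
    by apply: (expr_eq_mod zx); rewrite -modnMm !eE // modnMm.
  by apply: (expr_eq_mod (chix _ lK)); exact: eE.
have memJ j : j \in J -> exists n, exists2 k, k \in K & j = (x ^+ n * k)%g.
  by rewrite -defJ' => /mulsgP[_ k /cycleP[n ->] kK ->]; exists n, k.
have cK n k : k \in K -> commute k (x ^+ n)%g.
  by move=> kK; apply/(centsP cxK); rewrite ?mem_cycle.
have mulJ n m k l : k \in K ->
    (x ^+ n * k * (x ^+ m * l) = x ^+ (n + m) * (k * l))%g.
  move=> kK; rewrite expgD -!mulgA; congr (_ * _)%g.
  by rewrite !mulgA (cK m).
exists Y => //; split.
- move=> _ _ _ /memJ[n [k kK ->]] /memJ[m [l lK ->]] /memJ[o [t tK ->]].
  rewrite mulJ // !YE ?groupM // Xl // mulnDl !exprD; ring.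
- move=> _ _ _ /memJ[n [k kK ->]] /memJ[m [l lK ->]] /memJ[o [t tK ->]].
  rewrite mulJ // !YE ?groupM // Xr // mulnDr chiM // exprMn !exprD; ring.
- move=> _ _ /memJ[n [k kK ->]] /memJ[m [l lK ->]].
  rewrite YE // !normrM !normrX (norm1_of_expr _ zx) ?order_gt0 //.
  by rewrite (norm1_of_expr _ (chix _ lK)) ?order_gt0 // !expr1n Xn ?mulr1.
Qed.

Lemma abelian_cycle_ind (P : {group gT} -> Prop) :
    P 1%G ->
    (forall x J K, (<[x]> \x K)%g = J -> P K -> P J) ->
  forall J, abelian J -> P J.
Proof.
move=> P1 Pdprod J /abelian_structure[s defJ _].
elim: s J defJ => [|x s IH] J; rewrite ?big_nil ?big_cons => defJ.
  by rewrite -(group_inj defJ).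
have [[_ K _ defK] _ _ _] := dprodP defJ.
by apply: (Pdprod x _ K); [rewrite -defK | exact: IH].
Qed.

Lemma bichar_trivial : bichar 1%G (fun _ _ : gT => 1 : C).
Proof. by split=> *; rewrite ?mulr1 ?normr1. Qed.

Lemma bichar_alternating_asym J (beta : gT -> gT -> C) : bichar J beta ->
  {in J, forall j, beta j j = 1} -> {in J &, forall a c, beta a c = (beta c a)^-1}.
Proof.
move=> bB Balt a c aJ cJ; have [Bl Br _] := bB.
apply: (mulIf (bichar_neq0 bB cJ aJ)); rewrite mulVf ?(bichar_neq0 bB) //.
by have := Balt _ (groupM aJ cJ); rewrite Bl ?groupM // !Br // !Balt // mulr1 mul1r.
Qed.

(** Take the upper triangular half of beta: across each factor <x> x K, phi(x,l) = beta(x,l) while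
    phi(x,x) = phi(k,x) = 1. This realises every alternating bicharacter by a cocycle. *)
Lemma alternating_bichar_split J (beta : gT -> gT -> C) : abelian J -> bichar J beta ->
    {in J, forall j, beta j j = 1} ->
  exists2 phi, bichar J phi & {in J &, forall a c, phi a c / phi c a = beta a c}.
Proof.
move=> abJ; pattern J.
apply: (abelian_cycle_ind _ _ abJ) => {J abJ} [|x J K defJ IH] bB Balt.
  exists (fun _ _ => 1); first exact: bichar_trivial.
  by move=> a c; rewrite !inE => /eqP-> /eqP->; rewrite divr1 Balt ?group1.
have [_ defJ' cxK _] := dprodP defJ.
have sKJ : {subset K <= J} by apply/subsetP; rewrite -defJ' mulG_subr.
have xJ : x \in J by rewrite -defJ' (subsetP (mulG_subl K <[x]>%g)) ?cycle_id.
have [Bl Br Bn] := bB.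
have [||psi bpsi psiE] := IH.
- exact: bicharS bB.
- by move=> j /sKJ; exact: Balt.
have [|||phi bphi phiE] := @bichar_dprod_cycle J K x psi 1 (beta x) defJ bpsi.
- by rewrite expr1n.
- by move=> c d /sKJ cJ /sKJ dJ; rewrite Br.
- by move=> c /sKJ cJ; rewrite -(bicharXl _ bB) // expg_order (bichar1l bB).
exists phi => // a c; rewrite -defJ'.
move=> /mulsgP[_ k /cycleP[n ->] kK ->] /mulsgP[_ l /cycleP[m ->] lK ->].
have [kJ lJ] := (sKJ _ kK, sKJ _ lK).
have asym := bichar_alternating_asym bB Balt.
rewrite !phiE // !expr1n !mul1r Bl ?groupM ?groupX // !Br ?groupX //.
rewrite [beta (x ^+ n)%g (x ^+ m)%g](bicharXl _ bB) ?groupX //.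
rewrite [beta x (x ^+ m)%g]asym ?groupX // [beta k (x ^+ m)%g]asym ?groupX //.
rewrite !(bicharXl _ bB) // Balt // expr1n invr1 expr1n -(psiE _ _ kK lK) invfM.
ring.
Qed.
End CyclicDecomposition.

(** * Quaternionic elements and the sign q(j)^ord(j) *)

Section Quaternionic.
Variables (R : realType) (gT : finGroupType) (q : gT -> R[i]) (b : gT -> gT -> R[i]).
Hypothesis Q : quadratic_form q b.
Implicit Types (J : {group gT}) (j : gT).

Lemma b_diag j : b j j = (q j ^+ 2)^-1.
Proof.
have := qf_polar Q j j^-1%g; rewrite (qf_inv Q) mulgV (q1 Q) mul1r (bVr Q).
by rewrite -expr2 => ->; rewrite invrK.
Qed.

Lemma bXl g h n : b (g ^+ n)%g h = b g h ^+ n.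
Proof.
by elim: n => [|n IH]; rewrite ?(b1l Q) // expgS (bMl Q) IH exprS.
Qed.

Lemma qX j n : q (j ^+ n)%g = q j ^+ (n * n).
Proof.
elim: n => [|n IH]; first by rewrite (q1 Q).
rewrite expgSr (qM Q) IH bXl b_diag exprVn invrK -exprM -exprSr -exprD.
congr (_ ^+ _); lia.
Qed.

(** Here q(j)^-2 = b(j,j), whose order divides that of j. So q(j)^ord(j) is a sign, the obstruction
    to a quadratic bicharacter. *)
Lemma q_expr_order2 j : q j ^+ (2 * #[j]%g) = 1.
Proof.
apply: invr_inj; rewrite invr1 exprM -exprVn -b_diag -bXl expg_order.
exact: b1l Q _.
Qed.

(** With N = ord(j) even, b(j,j)^(N/2) = q(j)^-N = 1, so b(j,j) has order smaller than N. *)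
Lemma quaternionic_expr_order j : q j ^+ #[j]%g = 1 -> ~ quaternionic b j.
Proof.
move=> qj [[N_gt0 _ minN] evenN]; set N := #[j]%g in qj N_gt0 minN evenN.
have N2 : N = (2 * N./2)%N by rewrite -[LHS]odd_double_half (negPf evenN) mul2n.
have /minN/eqP[] : (0 < N./2 < N)%N by lia.
by rewrite b_diag exprVn -exprM -N2 qj invr1.
Qed.

(** If q(j)^N = -1 with N = ord(j), write N = M m with M the 2-part. Then j^m has order M and
    q(j^m)^M = (-1)^m = -1, so b(j^m,j^m)^(M/2) = -1 and j^m is a quaternionic element of J. *)
Lemma no_quaternionic_expr_order J : no_quaternionic b J ->
  {in J, forall j, q j ^+ #[j]%g = 1}.
Proof.
move=> noJ j jJ; apply/eqP/negPn/negP => qj_neq1.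
set N := #[j]%g in qj_neq1; have N_gt0 : (0 < N)%N := order_gt0 j.
have qjN : q j ^+ N = -1.
  apply/eqP; have := q_expr_order2 j; rewrite mulnC exprM => /eqP.
  by rewrite sqrf_eq1 (negPf qj_neq1).
set m := (N`_2^')%N; set M := (N`_2)%N.
have NE : N = (M * m)%N by rewrite /M /m partnC.
have odd_m : odd m by rewrite odd_2'nat part_pnat.
(* For odd N, 1 = q(j^N) = q(j)^(N^2) = (-1)^N = -1. *)
have evenN : ~~ odd N.
  apply/negP => oddN; move: qjN; have := qX j N.
  rewrite expg_order (q1 Q) exprM => + E; rewrite E -signr_odd oddN expr1.
  by move/eqP; rewrite -[1 == _]subr_eq0 opprK -[1 + 1]/(2%:R) pnatr_eq0.
have evenM : ~~ odd M by move: evenN; rewrite NE oddM odd_m andbT.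
have m_gt0 : (0 < m)%N by apply: part_gt0.
have M_gt0 : (0 < M)%N by apply: part_gt0.
have oM : #[j ^+ m]%g = M.
  by rewrite orderXdiv -/N NE ?dvdn_mull // mulnK.
apply: (noJ (j ^+ m)%g); first exact: groupX.
rewrite /quaternionic oM; split=> //.
have qM1 : q (j ^+ m)%g ^+ M = -1.
  rewrite qX -exprM -mulnA [(m * M)%N]mulnC -NE mulnC exprM qjN.
  by rewrite -signr_odd odd_m expr1.
have z_half : b (j ^+ m)%g (j ^+ m)%g ^+ M./2 != 1.
  rewrite b_diag exprVn -exprM mul2n halfK (negPf evenM) subn0 qM1 invrN1.
  by rewrite -subr_eq0 -opprD oppr_eq0 -[1 + 1]/(2%:R) pnatr_eq0.
set z := b _ _ in z_half *.
have zM : z ^+ M = 1 by rewrite /z -bXl -{1}oM expg_order (b1l Q).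
split=> // i /andP[i_gt0 lt_i]; apply/negP => /eqP zi.
(* The exact order d of z divides the 2-power M but not M/2, so d = M, against d <= i < M. *)
have [d prim_d d_dvdM] := prim_order_exists M_gt0 zM.
have d_dvdi : (d %| i)%N by rewrite (prim_order_dvd prim_d) zi.
have d_ndvd : ~~ (d %| M./2)%N by rewrite (prim_order_dvd prim_d).
have ltM : (d <= i)%N := dvdn_leq i_gt0 d_dvdi.
have M_half : M./2 = (2 ^ (logn 2 N).-1)%N.
  move: evenM; rewrite /M p_part; case: (logn 2 N) => // a _.
  by rewrite expnS mul2n doubleK.
move: d_dvdM; rewrite /M p_part => /(dvdn_pfactor _ _ (isT : prime 2))[c le_c dE].
have [c_eq|c_neq] := eqVneq c (logn 2 N).
  by move: ltM lt_i; rewrite dE c_eq /M p_part leqNgt => /negPf->.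
move: d_ndvd; rewrite M_half dE dvdn_exp2l //.
by move: le_c c_neq; rewrite leq_eqVlt => /orP[->//|]; case: (logn 2 N).
Qed.

(** Induction on cyclic factors with z = q(x) and cross term b(x,-)^-1: then Y(x^n k, x^n k) =
    q(x)^(n^2) b(x,k)^-n q(k) = q(x^n k). The hypothesis at x is what the extension step asks of
    z. *)
Lemma quad_bichar_exists J : {in J, forall j, q j ^+ #[j]%g = 1} ->
  exists X, quad_bichar q J X.
Proof.
have abJ := abelian_qf Q J.
pattern J; apply: (abelian_cycle_ind _ _ abJ) => {J abJ} [|x J K defJ IH] qJ.
  exists (fun _ _ => 1); split; first exact: bichar_trivial.
  by move=> j /set1P->; rewrite (q1 Q).
have [_ defJ' cxK _] := dprodP defJ.
have sKJ : {subset K <= J} by apply/subsetP; rewrite -defJ' mulG_subr.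
have xJ : x \in J by rewrite -defJ' (subsetP (mulG_subl K <[x]>%g)) ?cycle_id.
have [|X [bX Xq]] := IH; first by move=> j /sKJ; exact: qJ.
have [|||Y bY YE] := @bichar_dprod_cycle _ _ J K x X (q x)
  (fun c => (b x c)^-1) defJ bX.
- exact: qJ.
- by move=> c d _ _; rewrite (bMr Q) invfM.
- by move=> c _; rewrite exprVn -bXl expg_order (b1l Q) invr1.
exists Y; split=> // a; rewrite -defJ' => /mulsgP[_ k /cycleP[n ->] kK ->].
by rewrite YE // (qM Q) qX bXl Xq // exprVn mulrAC.
Qed.
End Quaternionic.

(** * Two-cocycles with values in the circle *)

Section Cocycle.
Variables (R : realType) (gT : finGroupType) (J : {group gT}).
Hypothesis abJ : abelian J.
Local Notation C := R[i].
Implicit Types phi psi : gT -> gT -> C.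

Definition alternation phi (a c : gT) : C := phi a c / phi c a.

Lemma cocycle_neq0 phi a c : cocycle2 J phi -> a \in J -> c \in J -> phi a c != 0.
Proof. by case=> phi1 _ aJ cJ; exact/norm1_neq0/phi1. Qed.

Lemma bichar_cocycle phi : bichar J phi -> cocycle2 J phi.
Proof.
move=> [Xl Xr Xn]; split=> [a c aJ cJ|a c d aJ cJ dJ]; first exact: Xn.
by rewrite Xl ?Xr //; ring.
Qed.

Lemma alternation_bichar phi : cocycle2 J phi -> bichar J (alternation phi).
Proof.
move=> cphi; have [phi1 phiE] := cphi.
have neq0 a c : a \in J -> c \in J -> phi a c != 0 by exact: cocycle_neq0.
have altV a c : alternation phi a c = (alternation phi c a)^-1.
  by rewrite /alternation invf_div.
have Xl : {in J & &, forall a c d,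
    alternation phi (a * c)%g d = alternation phi a d * alternation phi c d}.
  move=> a c d aJ cJ dJ; rewrite /alternation mulf_div.
  (* The cocycle identity for (a,c,d), (d,a,c) and (a,d,c); combined, they leave the wanted relation
     times the common factor N. *)
  have E1 := phiE _ _ _ aJ cJ dJ; have E2 := phiE _ _ _ dJ aJ cJ.
  have E3 := phiE _ _ _ aJ dJ cJ.
  rewrite (centsP abJ c cJ d dJ) in E1; rewrite (centsP abJ d dJ a aJ) in E2.
  have acJ := groupM aJ cJ; have adJ := groupM aJ dJ; have cdJ := groupM cJ dJ.
  apply/eqP; rewrite eqr_div ?mulf_neq0 ?neq0 //; apply/eqP.
  have dcJ := groupM dJ cJ.
  have N : phi a c * phi (a * d)%g c * phi a (d * c)%g != 0.
    by rewrite !mulf_neq0 ?neq0.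
  apply: (mulfI N).
  transitivity ((phi (a * c)%g d * phi a c) * (phi (a * d)%g c * phi d a)
      * (phi d c * phi a (d * c)%g)); first by ring.
  by rewrite -E1 -E2 E3; ring.
split=> // [a c d aJ cJ dJ|a c aJ cJ].
  by rewrite altV Xl // invfM -!altV.
by rewrite /alternation normf_div !phi1 ?divr1.
Qed.

Lemma alternation_id phi a : cocycle2 J phi -> a \in J -> alternation phi a a = 1.
Proof. by move=> cphi aJ; rewrite /alternation divff ?cocycle_neq0. Qed.

(** On an abelian group a coboundary is symmetric, so it cancels in the alternation. *)
Lemma cohomologous_alternation phi psi : cocycle2 J phi ->
  cohomologous J phi psi -> {in J &, alternation phi =2 alternation psi}.
Proof.
move=> cphi [f [f1 psiE]] a c aJ cJ.
have f_neq0 d : d \in J -> f d != 0 by move/f1/norm1_neq0.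
rewrite /alternation !psiE // (centsP abJ c cJ a aJ) [f c * f a]mulrC.
by rewrite -mulf_div divff ?mulr1 // !mulf_neq0 ?invr_eq0 ?f_neq0 ?groupM.
Qed.

(* The twisted regular representation [a |-> U_a], with U_a U_c = phi a c U_(ac),
   is commutative for symmetric phi, and the eigenvalues on a common eigenvector
   trivialise phi. *)
Lemma symmetric_cocycle_coboundary phi : cocycle2 J phi ->
    {in J &, forall a c, phi a c = phi c a} ->
  exists f : gT -> C, {in J, forall a, `|f a| = 1} /\
    {in J &, forall a c, f a * f c = phi a c * f (a * c)%g}.
Proof.
move=> cphi symphi; have [phi1 phiE] := cphi.
have neq0 a c : a \in J -> c \in J -> phi a c != 0 by exact: cocycle_neq0.
pose v (i : 'I_#|J|) := enum_val i.
have vJ i : v i \in J := enum_valP i.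
(* On row vectors e_v U_a = phi(a,v) e_(av), so matrix products appear in the opposite order. *)
pose U a : 'M[C]_#|J| := \matrix_(i, j) (phi a (v i) *+ (a * v i == v j)%g).
have UM a c : a \in J -> c \in J -> U c *m U a = phi a c *: U (a * c)%g.
  move=> aJ cJ; apply/matrixP => i k; rewrite !mxE.
  have cvJ : (c * v i)%g \in J by rewrite groupM.
  pose j := enum_rank_in cvJ (c * v i)%g.
  have vj : v j = (c * v i)%g by rewrite /v /j enum_rankK_in.
  rewrite (bigD1 j) //= big1 => [|l lj]; last first.
    rewrite !mxE -vj; case: eqP => [E|_]; last by rewrite mul0r.
    by case/eqP: lj; apply: enum_val_inj.
  rewrite addr0 !mxE vj eqxx mulr1n mulgA; case: eqP; rewrite ?mulr0 // !mulr1n.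
  by rewrite phiE // mulrC.
have card_gt0 : (0 < #|J|)%N by exact: cardG_gt0.
have comU : {in [seq U a | a <- enum J] &, forall A B, comm_mx A B}.
  move=> _ _ /mapP[a + ->] /mapP[c + ->]; rewrite !mem_enum => aJ cJ.
  by rewrite /comm_mx !UM // symphi // (centsP abJ a aJ c cJ).
have [w w_neq0 /allP stabU] := common_eigenvector card_gt0 comU.
have /choice[f fE] : forall a, exists c, a \in J -> w *m U a = c *: w.
  move=> a; have [aJ|aJ] := boolP (a \in J); last by exists 0.
  have /sub_rVP[c cE] := stabU (U a) (map_f U (etrans (mem_enum J a) aJ)).
  by exists c.
have fM : {in J &, forall a c, f a * f c = phi a c * f (a * c)%g}.
  move=> a c aJ cJ; have /eqP : (f a * f c) *: w = (phi a c * f (a * c)%g) *: w.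
    rewrite -[RHS]scalerA -fE ?groupM // scalemxAr -UM // mulmxA !fE //.
    by rewrite -scalemxAl fE // scalerA mulrC.
  by rewrite -subr_eq0 -scalerBl scaler_eq0 (negPf w_neq0) orbF subr_eq0 => /eqP.
(* U_1 is diagonal with the nonzero entries phi(1,v), so it cannot kill w. *)
have f1_neq0 : f 1%g != 0.
  apply: contraNneq w_neq0 => f1_0; apply/eqP/rowP => j; rewrite mxE.
  have := congr1 (fun u : 'rV_ _ => u 0 j) (fE 1%g (group1 J)).
  rewrite f1_0 scale0r !mxE (bigD1 j) //= big1 => [|i ij]; last first.
    rewrite mxE mul1g; case: eqP => [/enum_val_inj E|_]; last by rewrite mulr0.
    by rewrite E eqxx in ij.
  rewrite mxE mul1g eqxx mulr1n addr0 => /eqP; rewrite mulf_eq0.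
  by rewrite (negPf (neq0 _ _ (group1 J) (vJ j))) orbF => /eqP.
have nM : {in J &, forall a c, `|f (a * c)%g| = `|f a| * `|f c|}.
  by move=> a c aJ cJ; rewrite -normrM fM // normrM phi1 // mul1r.
have n1 : `|f 1%g| = 1.
  have /mulfI : `|f 1%g| != 0 by rewrite normr_eq0.
  by apply; rewrite -nM ?group1 // mulg1 mulr1.
exists f; split=> // a aJ.
have nX n : `|f (a ^+ n)%g| = `|f a| ^+ n.
  by elim: n => [|n IH]; rewrite ?n1 // expgS nM ?groupX // IH exprS.
have := nX #[a]%g; rewrite expg_order n1 => /esym/norm1_of_expr.
by rewrite normr_id; apply; exact: order_gt0.
Qed.

(** The quotient psi/phi is a symmetric cocycle, hence a coboundary. *)
Lemma alternation_cohomologous phi psi : cocycle2 J phi -> cocycle2 J psi ->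
  {in J &, alternation phi =2 alternation psi} -> cohomologous J phi psi.
Proof.
move=> cphi cpsi altE; have [phi1 phiE] := cphi; have [psi1 psiE] := cpsi.
have neq0 a c : a \in J -> c \in J -> phi a c != 0 by exact: cocycle_neq0.
have neq0' a c : a \in J -> c \in J -> psi a c != 0 by exact: cocycle_neq0.
have [||f [f1 fE]] := @symmetric_cocycle_coboundary (fun a c => psi a c / phi a c).
- split=> [a c aJ cJ|a c d aJ cJ dJ].
    by rewrite /in_T normf_div psi1 ?phi1 ?divr1.
  by rewrite !mulf_div psiE // phiE.
- move=> a c aJ cJ; apply/eqP; rewrite eqr_div ?neq0 //.
  have /eqP := altE a c aJ cJ; rewrite /alternation eqr_div ?neq0 ?neq0' //.
  by move/eqP=> E; apply/eqP; rewrite -E mulrC.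
exists f; split=> // a c aJ cJ.
have fac : f (a * c)%g != 0 by apply: norm1_neq0; rewrite f1 ?groupM.
by rewrite fE // mulfK // mulrC divfK ?neq0.
Qed.
End Cocycle.

(** * Lagrangian subgroups as fibre products *)

Section Goursat.
Variables (R : realType) (gT : finGroupType) (q : gT -> R[i]) (b : gT -> gT -> R[i]).
Hypothesis Q : quadratic_form q b.
Implicit Types (D : {group gT}) (W : {group gT * gT}) (g h : gT).

Lemma norm_qf D g : g \in 'N(D)%g.
Proof.
apply: (subsetP (sub_abelian_norm (abelian_qf Q [set: gT]) (subsetT D))).
by rewrite inE.
Qed.

Lemma coset_qfM D g h : coset D (g * h)%g = (coset D g * coset D h)%g.
Proof. by rewrite morphM ?norm_qf. Qed.

Lemma coset_qfP D g h : reflect (coset D g = coset D h) ((g * h^-1)%g \in D).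
Proof. by rewrite -mem_rcoset; apply: rcoset_kercosetP; exact: norm_qf. Qed.

Lemma isotropic_sub_perp D : {in D, forall d, q d = 1} -> {subset D <= perp b D}.
Proof.
move=> qD d dD; apply/perpP => e eD; have := qf_polar Q d e.
by rewrite !qD ?groupM // !mul1r.
Qed.

Lemma mem_perp_coset D g : {in D, forall d, q d = 1} ->
  (coset D g \in (perp b D / D)%g) = (g \in perp b D).
Proof.
move=> qD; apply/idP/idP => [/morphimP[k _ kD /coset_qfP gk]|gD].
  rewrite -(mulgKV k g); apply: (groupM (G := perp_group Q D)) => //=.
  exact: isotropic_sub_perp.
exact: (mem_quotient D (G := perp_group Q D)).
Qed.

Lemma repr_coset_qf D g : exists2 d, d \in D & repr (coset D g) = (d * g)%g.
Proof.
have := mem_repr_coset (coset D g).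
by rewrite val_coset ?norm_qf // => /rcosetP[d dD ->]; exists d.
Qed.

Lemma q_repr_coset D g : {in D, forall d, q d = 1} -> g \in perp b D ->
  q (repr (coset D g)) = q g.
Proof.
move=> qD /perpP gD; have [d dD ->] := repr_coset_qf D g.
by rewrite (qM Q) qD // (b_sym Q) gD // divr1 mul1r.
Qed.

Lemma cosetW D (c : coset_of D) : exists g, c = coset D g.
Proof. by have [g _ ->] := cosetP c; exists g. Qed.

Definition fibre_product Dp Dm (sigma : coset_of Dp -> coset_of Dm) W :=
  forall g h, (g, h) \in W <->
    [/\ g \in perp b Dp, h \in perp b Dm & sigma (coset Dp g) = coset Dm h].

Section OneTriple.
Variables (Dp Dm : {group gT}) (sigma : {ffun coset_of Dp -> coset_of Dm}).
Hypothesis ok : triple_ok q b sigma.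
Let qp : {in Dp, forall d, q d = 1}. Proof. by case: ok. Qed.
Let qm : {in Dm, forall d, q d = 1}. Proof. by case: ok. Qed.

Let sigmaM g h : g \in perp b Dp -> h \in perp b Dp ->
  sigma (coset Dp (g * h)%g) = (sigma (coset Dp g) * sigma (coset Dp h))%g.
Proof.
by case: ok => _ _ [sM _ _ _ _] gP hP; rewrite coset_qfM sM ?mem_perp_coset.
Qed.

Let sigma1 : sigma 1%g = 1%g.
Proof.
have := sigmaM (group1 (perp_group Q Dp)) (group1 (perp_group Q Dp)).
rewrite mulg1 coset_id ?group1 // -[X in X = _]mulg1 => /mulgI/esym //.
Qed.

Lemma fibre_product_exists : exists W, fibre_product sigma W.
Proof.
pose V := [set z : gT * gT | [&& z.1 \in perp b Dp, z.2 \in perp b Dm &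
  sigma (coset Dp z.1) == coset Dm z.2]].
have inV g h : reflect [/\ g \in perp b Dp, h \in perp b Dm
    & sigma (coset Dp g) = coset Dm h] ((g, h) \in V).
  by rewrite [_ \in V]inE; apply: (iffP and3P) => -[? ? /eqP].
have gV : group_set V.
  apply/group_setP; split.
    apply/inV; rewrite !(group1 (perp_group Q _)) !coset_id ?group1 //.
  move=> [g h] [g' h'] /inV[gP hP gh] /inV[gP' hP' gh']; apply/inV.
  rewrite (groupM (G := perp_group Q Dp)) // (groupM (G := perp_group Q Dm)) //.
  by rewrite sigmaM // gh gh' coset_qfM.
by exists (Group gV) => g h; split=> [/inV|ghW]; last exact/inV.
Qed.

Lemma fibre_productl W g : fibre_product sigma W -> (g, 1%g) \in W <-> g \in Dp.
Proof.
have [_ _ [_ sI _ _ _]] := ok; move=> gW; split=> [/gW[gP _ gs]|gD].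
  rewrite -[g]mulg1 -invg1; apply/coset_qfP; apply: sI; rewrite ?mem_perp_coset //.
    exact: group1 (perp_group Q Dp).
  by rewrite gs !coset_id ?group1.
apply/gW; rewrite (group1 (perp_group Q Dm)) isotropic_sub_perp //.
by rewrite !coset_id ?group1.
Qed.

Lemma fibre_productr W h : fibre_product sigma W -> (1%g, h) \in W <-> h \in Dm.
Proof.
move=> gW; split=> [/gW[_ hP]|hD].
  rewrite coset_id ?group1 // sigma1 => /esym hs.
  by rewrite -[h]mulg1 -invg1; apply/coset_qfP; rewrite hs coset_id ?group1.
apply/gW; rewrite (group1 (perp_group Q Dp)) isotropic_sub_perp //.
by rewrite !coset_id ?group1.
Qed.

Lemma fibre_product_total W g : fibre_product sigma W -> g \in perp b Dp ->
  exists h, (g, h) \in W.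
Proof.
have [_ _ [_ _ sQ _ _]] := ok; move=> gW gP.
have [h hE] := cosetW (sigma (coset Dp g)); exists h; apply/gW; split=> //.
by rewrite -mem_perp_coset // -sQ -hE imset_f // mem_perp_coset.
Qed.

Lemma fibre_product_onto W h : fibre_product sigma W -> h \in perp b Dm ->
  exists g, (g, h) \in W.
Proof.
have [_ _ [_ _ sQ _ _]] := ok; move=> gW hP.
have : coset Dm h \in (perp b Dm / Dm)%g by rewrite mem_perp_coset.
rewrite -sQ => /imsetP[c cP hE]; have [g gE] := cosetW c.
by exists g; apply/gW; rewrite -mem_perp_coset // -gE.
Qed.

(** Isotropy holds because sigma preserves q. For maximality, orthogonality to D_+ x 1 and 1 x D_-
    puts g in D_+^perp and h in D_-^perp; for (g,h') in W, the quotient h' h^-1 is orthogonal to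
    D_-^perp, so it lies in D_-. *)
Lemma fibre_product_lagrangian W : fibre_product sigma W -> lagrangian q b W.
Proof.
have [_ _ [_ _ _ _ sq]] := ok; move=> gW; apply: (lagrangianP Q) => -[g h].
  move=> /gW[gP hP gh]; apply/(q2_eq1 Q) => /=.
  by rewrite -(q_repr_coset qp gP) -(q_repr_coset qm hP) -gh sq ?mem_perp_coset.
move=> ghW; have bgh k l : (k, l) \in W -> b g k = b h l.
  by move/ghW/(pair2_eq1 Q).
have gP : g \in perp b Dp.
  by apply/perpP => d /(fibre_productl d gW)/bgh; rewrite (b1r Q).
have [h' ghW'] := fibre_product_total gW gP; have [_ hP' gh'] := (proj1 (gW _ _) ghW').
have hP : h \in perp b Dm.
  by apply/perpP => d /(fibre_productr d gW)/bgh; rewrite (b1r Q).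
have qW z : z \in W -> q2 q z = 1.
  case: z => k l /gW[kP lP kl]; apply/(q2_eq1 Q) => /=.
  by rewrite -(q_repr_coset qp kP) -(q_repr_coset qm lP) -kl sq ?mem_perp_coset.
apply/gW; split=> //; rewrite gh'; apply/esym/coset_qfP.
rewrite -(perpK Q Dm); apply/perpP => l /(fibre_product_onto gW)[k klW].
have /(pair2_eq1 Q)/= := isotropic_perp2 Q qW ghW' klW.
by rewrite (bgh _ _ klW) (bMl Q) (bVl Q) => ->; rewrite divff ?(b_neq0 Q).
Qed.
End OneTriple.

(** The slices of W give D_+ and D_-, W gives sigma on the quotient, and the normalisation fixes
    sigma elsewhere. *)
Lemma fibre_product_inj (T T' : Triples q b) W :
  fibre_product (sval (projT2 T)) W -> fibre_product (sval (projT2 T')) W -> T = T'.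
Proof.
case: T T' => -[Dp Dm] [s ok] [[Dp' Dm'] [s' ok']] /= gW gW'.
have eDp : Dp = Dp'.
  apply/group_inj/setP => g; apply/idP/idP.
    by move/(fibre_productl ok g gW)/(fibre_productl ok' g gW').
  by move/(fibre_productl ok' g gW')/(fibre_productl ok g gW).
have eDm : Dm = Dm'.
  apply/group_inj/setP => g; apply/idP/idP.
    by move/(fibre_productr ok g gW)/(fibre_productr ok' g gW').
  by move/(fibre_productr ok' g gW')/(fibre_productr ok g gW).
subst Dp' Dm'; have es : s = s'.
  have [qp _ [_ _ _ s1 _]] := ok; have [_ _ [_ _ _ s1' _]] := ok'.
  apply/ffunP => c; have [cP|cP] := boolP (c \in (perp b Dp / Dp)%g); last first.
    by rewrite s1 ?s1'.
  have [g gE] := cosetW c; rewrite gE mem_perp_coset // in cP *.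
  have [h ghW] := fibre_product_total ok gW cP.
  by have [_ _ ->] := proj1 (gW _ _) ghW; have [_ _ ->] := proj1 (gW' _ _) ghW.
by subst s'; rewrite (Prop_irrelevance ok ok').
Qed.

(** D_+ and D_- are the slices of W; sigma sends the class of g to that of any h with (g,h) in W. *)
Lemma lagrangian_fibre_product W : lagrangian q b W ->
  exists T : Triples q b, fibre_product (sval (projT2 T)) W.
Proof.
move=> [perpW qW].
have bW g h g' h' : (g, h) \in W -> (g', h') \in W -> b g g' = b h h'.
  move=> ghW ghW'.
  exact/(pair2_eq1 Q (g, h) (g', h'))/(isotropic_perp2 Q qW ghW ghW').
have maxW g h : (forall g' h', (g', h') \in W -> b g g' = b h h') -> (g, h) \in W.
  move=> gh; rewrite -perpW; apply/(perpP (pair2 b)) => -[g' h'] ghW'.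
  exact/(pair2_eq1 Q (g, h) (g', h'))/gh.
have gl : group_set [set g | (g, 1%g) \in W].
  apply/group_setP; split=> [|g h]; rewrite !inE ?group1 // => gW hW.
  by have := groupM gW hW; congr (_ \in W); congr pair; rewrite /= mulg1.
have gr : group_set [set h | (1%g, h) \in W].
  apply/group_setP; split=> [|g h]; rewrite !inE ?group1 // => gW hW.
  by have := groupM gW hW; congr (_ \in W); congr pair; rewrite /= mulg1.
have pl : group_set [set z.1 | z in W].
  apply/group_setP; split=> [|_ _ /imsetP[z zW ->] /imsetP[w wW ->]].
    by apply/imsetP; exists 1%g.
  by apply/imsetP; exists (z * w)%g; rewrite ?groupM.
have pr : group_set [set z.2 | z in W].
  apply/group_setP; split=> [|_ _ /imsetP[z zW ->] /imsetP[w wW ->]].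
    by apply/imsetP; exists 1%g.
  by apply/imsetP; exists (z * w)%g; rewrite ?groupM.
pose Dp := Group gl; pose Dm := Group gr.
(* An element orthogonal to the first projection of W is a g with (g,1) in W^perp = W, that is, an
   element of D_+; now take orthogonals. *)
have perpl : perp b Dp = [set z.1 | z in W].
  rewrite -[RHS](perpK Q (Group pl)); congr perp; apply/setP => g; rewrite inE.
  apply/idP/perpP => [gW _ /imsetP[[k l] klW ->]|gP].
    by rewrite (bW _ _ _ _ gW klW) (b1l Q).
  by apply: maxW => k l klW; rewrite (b1l Q) gP //; apply/imsetP; exists (k, l).
have perpr : perp b Dm = [set z.2 | z in W].
  rewrite -[RHS](perpK Q (Group pr)); congr perp; apply/setP => g; rewrite inE.
  apply/idP/perpP => [gW _ /imsetP[[k l] klW ->]|gP].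
    by rewrite -(bW _ _ _ _ gW klW) (b1l Q).
  by apply: maxW => k l klW; rewrite (b1l Q) gP //; apply/imsetP; exists (k, l).
have inPl g : g \in perp b Dp -> exists h, (g, h) \in W.
  by rewrite perpl => /imsetP[[k l] klW ->]; exists l.
have inPr h : h \in perp b Dm -> exists g, (g, h) \in W.
  by rewrite perpr => /imsetP[[k l] klW ->]; exists k.
have Wl g h : (g, h) \in W -> g \in perp b Dp.
  by move=> ghW; rewrite perpl; apply/imsetP; exists (g, h).
have Wr g h : (g, h) \in W -> h \in perp b Dm.
  by move=> ghW; rewrite perpr; apply/imsetP; exists (g, h).
have qWE g h : (g, h) \in W -> q g = q h by move/qW/(q2_eq1 Q).
have qp : {in Dp, forall d, q d = 1}.
  by move=> d; rewrite inE => /qWE->; exact: q1 Q.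
have qm : {in Dm, forall d, q d = 1}.
  by move=> d; rewrite inE => /qWE<-; exact: q1 Q.
(* Outside D_+^perp/D_+ no h lies over [repr c], and the default 1 is the required normalisation. *)
pose sigma0 (c : coset_of Dp) : coset_of Dm :=
  if [pick h | (repr c, h) \in W] is Some h then coset Dm h else 1%g.
pose sigma : {ffun coset_of Dp -> coset_of Dm} := finfun sigma0.
have divW g h g' h' : (g, h) \in W -> (g', h') \in W ->
    (g * g'^-1, h * h'^-1)%g \in W.
  by move=> ghW ghW'; exact: (groupM ghW (groupVr ghW')).
have sigmaE g h : (g, h) \in W -> sigma (coset Dp g) = coset Dm h.
  move=> ghW; have [d] := repr_coset_qf Dp g; rewrite inE => dW dE.
  have dghW : (d * g, h)%g \in W.
    by have := groupM dW ghW; congr (_ \in W); congr pair; exact: mul1g.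
  rewrite ffunE /sigma0 dE; case: pickP => [h' hW'|/(_ h)]; last by rewrite dghW.
  by apply/coset_qfP; rewrite inE; have := divW _ _ _ _ hW' dghW; rewrite mulgV.
have ok : triple_ok q b sigma.
  split=> //; split.
  - move=> c1 c2; have [g1 ->] := cosetW c1; have [g2 ->] := cosetW c2.
    rewrite !mem_perp_coset // => /inPl[h1 W1] /inPl[h2 W2].
    rewrite -coset_qfM (sigmaE _ _ (groupM W1 W2)).
    by rewrite (sigmaE _ _ W1) (sigmaE _ _ W2) coset_qfM.
  - move=> c1 c2; have [g1 ->] := cosetW c1; have [g2 ->] := cosetW c2.
    rewrite !mem_perp_coset // => /inPl[h1 W1] /inPl[h2 W2].
    rewrite (sigmaE _ _ W1) (sigmaE _ _ W2) => /coset_qfP; rewrite inE => hW.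
    apply/coset_qfP; rewrite inE; have := divW _ _ _ _ (divW _ _ _ _ W1 W2) hW.
    by rewrite invg1 mulg1 mulgV.
  - apply/setP => c; apply/imsetP/idP => [[c'] + ->|].
      have [g ->] := cosetW c'; rewrite mem_perp_coset // => /inPl[h ghW].
      by rewrite (sigmaE _ _ ghW) mem_perp_coset // (Wr _ _ ghW).
    have [h ->] := cosetW c; rewrite mem_perp_coset // => /inPr[g ghW].
    by exists (coset Dp g); rewrite ?mem_perp_coset ?(Wl _ _ ghW) // (sigmaE _ _ ghW).
  - move=> c cP; rewrite ffunE /sigma0; case: pickP => // h /Wl.
    by rewrite -mem_perp_coset // coset_reprK (negPf cP).
  - move=> c; have [g ->] := cosetW c; rewrite mem_perp_coset // => gP.
    have [h ghW] := inPl _ gP; rewrite (sigmaE _ _ ghW) !q_repr_coset //.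
      by rewrite (qWE _ _ ghW).
    exact: Wr ghW.
exists (existT _ (Dp, Dm) (exist _ sigma ok)) => g h /=; split=> [ghW|[gP hP gh]].
  by split; [exact: Wl ghW | exact: Wr ghW | exact: sigmaE].
have [h' ghW'] := inPl _ gP.
have /coset_qfP : coset Dm h' = coset Dm h := etrans (esym (sigmaE _ _ ghW')) gh.
rewrite inE => hW; have := divW _ _ _ _ ghW' hW.
by rewrite invg1 mulg1 invMg invgK mulgA (qf_comm Q h') mulgK.
Qed.
End Goursat.

(** * The three bijections *)

Lemma inj_surj_bijective (T U : Type) (f : T -> U) :
  injective f -> (forall y, exists x, f x = y) -> bijective f.
Proof. by move=> injf /choice[g gK]; exists g => // x; apply: injf; rewrite gK. Qed.

Lemma bijective_inverse (T U : Type) (f : T -> U) :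
  bijective f -> exists g : U -> T, bijective g.
Proof. by case=> g fK gK; exists g; exists f. Qed.

Section Correspondences.
Variables (R : realType) (gT : finGroupType) (q : gT -> R[i]) (b : gT -> gT -> R[i]).
Hypothesis Q : quadratic_form q b.
Variables (x : R[i]) (x_neq0 : x != 0).
Local Notation C := R[i].
Implicit Types (J : {group gT}) (phi : gT -> gT -> C).

Lemma lagrangian_inj (L L' : Lagrangians q b) : sval L = sval L' -> L = L'.
Proof.
by case: L L' => W p [W' p'] /= E; subst W'; rewrite (Prop_irrelevance p p').
Qed.

Lemma lagrangians_modular_invariants :
  exists f : Lagrangians q b -> ModInv q b x, bijective f.
Proof.
exists (fun L => exist _ _ (lagrangian_modular_invariant Q x_neq0 (svalP L))).
apply: inj_surj_bijective => [L L' /(congr1 sval)/= /ffunP E|[Z mZ]].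
  apply/lagrangian_inj/group_inj/setP => z.
  by have := E z; rewrite !ffunE; do 2 case: (_ \in _).
have [W lagW ZE] := modular_invariant_lagrangian Q x_neq0 mZ.
exists (exist _ W lagW); subst Z; congr exist; exact: Prop_irrelevance.
Qed.

Lemma triples_lagrangians : exists f : Triples q b -> Lagrangians q b, bijective f.
Proof.
have /choice[f fE] : forall T : Triples q b, exists L : Lagrangians q b,
    fibre_product b (sval (projT2 T)) (sval L).
  move=> T; have [W TW] := fibre_product_exists Q (svalP (projT2 T)).
  by exists (exist _ W (fibre_product_lagrangian Q (svalP (projT2 T)) TW)).
exists f; apply: inj_surj_bijective => [T T' E|L].
  by apply: (fibre_product_inj Q (fE T)); rewrite E; exact: fE.
have [T TL] := lagrangian_fibre_product Q (svalP L); exists T.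
apply/lagrangian_inj/group_inj/setP => -[g h].
by apply/idP/idP => [/(proj1 (fE T g h))|/(proj1 (TL g h))] E; [apply/TL | apply/fE].
Qed.

(** On each J without quaternionic elements, the quadratic bicharacters form a torsor under the
    alternating ones. A base point [X0 J] turns (J,phi) into [X0 J] times the alternation of phi,
    which is then glued. *)
Lemma modular_invariants_cohomology :
  exists F : {group gT} -> (gT -> gT -> C) -> ModInv q b x,
    (forall Z : ModInv q b x, exists J phi,
       [/\ no_quaternionic b J, cocycle2 J phi & F J phi = Z]) /\
    (forall J J' phi phi',
       no_quaternionic b J -> cocycle2 J phi ->
       no_quaternionic b J' -> cocycle2 J' phi' ->
       (F J phi = F J' phi' <-> J = J' /\ cohomologous J phi phi')).
Proof.
have [f bij_f] := lagrangians_modular_invariants.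
have abJ J : abelian J := abelian_qf Q J.
have /choice[X0 X0E] : forall J, exists X, no_quaternionic b J -> quad_bichar q J X.
  move=> J; have [/(no_quaternionic_expr_order Q)/(quad_bichar_exists Q)[X qX]|noJ] :=
    pselect (no_quaternionic b J); first by exists X.
  by exists (fun _ _ => 1).
have quadX J phi : no_quaternionic b J -> cocycle2 J phi ->
    quad_bichar q J (fun a c => X0 J a c * alternation phi a c).
  move=> /X0E[bX Xq] cphi; split.
    exact: bicharM bX (alternation_bichar (abJ J) cphi).
  by move=> j jJ; rewrite Xq // (alternation_id cphi jJ) mulr1.
(* A default Lagrangian, glued from J = 1, for pairs (J,phi) that violate the hypotheses. *)
have [L0 _] : exists L : Lagrangians q b, True.
  have [|X qX] := quad_bichar_exists Q (J := 1%G).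
    by move=> j /set1P->; rewrite (q1 Q) expr1n.
  have [W gW] := glue_exists Q qX.
  by exists (exist _ W (glue_lagrangian Q qX gW)).
have /choice[F FE] : forall Jphi : {group gT} * (gT -> gT -> C),
    exists L : Lagrangians q b,
    no_quaternionic b Jphi.1 -> cocycle2 Jphi.1 Jphi.2 ->
    glue b Jphi.1 (fun a c => X0 Jphi.1 a c * alternation Jphi.2 a c) (sval L).
  move=> [J phi] /=; have [noJ|?] := pselect (no_quaternionic b J); last by exists L0.
  have [cphi|?] := pselect (cocycle2 J phi); last by exists L0.
  have qX := quadX _ _ noJ cphi; have [W gW] := glue_exists Q qX.
  by exists (exist _ W (glue_lagrangian Q qX gW)).
exists (fun J phi => f (F (J, phi))); split=> [Z|J J' phi phi' noJ cphi noJ' cphi'].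
  have [g fK gK] := bij_f; have [J [X [[bX Xq] gX]]] := lagrangian_glue Q (svalP (g Z)).
  have noJ : no_quaternionic b J.
    move=> j jJ; apply: (quaternionic_expr_order Q).
    by rewrite -Xq // -(bicharXl _ bX) // expg_order (bichar1l bX).
  have [bX0 X0q] := X0E J noJ.
  (* X / [X0 J] is trivial on the diagonal, hence the alternation of some phi. *)
  have [||phi bphi phiE] := alternating_bichar_split (abJ J)
    (beta := fun a c => X a c * (X0 J a c)^-1).
  - exact: bicharM bX (bicharV bX0).
  - by move=> j jJ; rewrite Xq // X0q // divff ?(q_neq0 Q).
  have cphi := bichar_cocycle bphi.
  exists J, phi; split=> //; rewrite -[RHS]gK; congr f; apply/lagrangian_inj.
  apply: (glue_fun (FE (J, phi) noJ cphi)) => /=.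
  apply: eq_glue gX => a c aJ cJ /=.
  by rewrite /alternation phiE // mulrC divfK ?(bichar_neq0 bX0).
have gF := FE (J, phi) noJ cphi; have gF' := FE (J', phi') noJ' cphi'.
have [bY _] := quadX _ _ noJ cphi; have [bY' _] := quadX _ _ noJ' cphi'.
split=> [/(bij_inj bij_f) E|[E cohom]].
  rewrite -E /= in gF' gF; have [eJ eX] := glue_inj Q bY bY' gF gF'.
  subst J'; split=> //; apply: alternation_cohomologous => // a c aJ cJ.
  have [bX0 _] := X0E J noJ.
  exact: (mulfI (bichar_neq0 bX0 aJ cJ)) (eX a c aJ cJ).
subst J'; congr f; apply/lagrangian_inj; apply: (glue_fun gF) => /=.
apply: eq_glue gF' => a c aJ cJ /=.
by rewrite (cohomologous_alternation (abJ J) cphi cohom).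
Qed.
End Correspondences.

Unset Implicit Arguments.

Theorem theorem3 (R : realType) (n : nat) (A : 'M[R]_n) (gT : finGroupType)
    (p : 'rV[R]_n -> gT) (q : gT -> R[i]) (b : gT -> gT -> R[i]) (x : R[i]) :
  even_pd_lattice A -> discriminant_data A p q b -> x != 0 ->
  [/\ (* (i) <-> (ii) : F induces a bijection from
         { (J, [phi]) : J <= G without quaternionic elements, [phi] in H^2(J;T) } *)
      (exists F : {group gT} -> (gT -> gT -> R[i]) -> ModInv q b x,
         (forall Z : ModInv q b x, exists (J : {group gT}) (phi : gT -> gT -> R[i]),
             [/\ no_quaternionic b J, cocycle2 J phi & F J phi = Z]) /\
         (forall (J J' : {group gT}) (phi phi' : gT -> gT -> R[i]),
             no_quaternionic b J -> cocycle2 J phi ->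
             no_quaternionic b J' -> cocycle2 J' phi' ->
             (F J phi = F J' phi' <-> J = J' /\ cohomologous J phi phi'))),
      (* (i) <-> (iii) *)
      (exists f : ModInv q b x -> Triples q b, bijective f)
    & (* (i) <-> (iv) *)
      (exists f : ModInv q b x -> Lagrangians q b, bijective f)].
Proof.
move=> latA /(discriminant_quadratic_form latA) Q x_neq0.
have [f bij_f] := lagrangians_modular_invariants Q x_neq0.
have [g bij_g] := triples_lagrangians Q.
split; first exact: modular_invariants_cohomology.
  exact: bijective_inverse (bij_comp bij_f bij_g).
exact: bijective_inverse bij_f.
Qed.
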